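(* Let $n\ge 2$, $p \geq 1$, let $v^1,\dots,v^p$ be distinct points of $\mathbb{TP}^{n-1}$, and let $\mathcal{P}$ be the tropical polytope generated by $v^1,\dots,v^p$. Assume that $\mathcal{P}$ is pure. Then there exists a lift $\boldsymbol{P}$ of $\mathcal{P}$ such that the images under the valuation map of the facet-defining half-spaces of $\boldsymbol{P}$ are tropical half-spaces whose intersection is $\mathcal{P}$. If, in addition, the generators $v^1,\dots,v^p$ are in general position, then every lift $\boldsymbol{P}$ of $\mathcal{P}$ has this property.
   Context: Tropical projective space: $\mathbb{TP}^{n-1} = \mathbb{R}^n/\mathbb{R}(1,\dots,1)$, with the topology induced by the usual topology of $\mathbb{R}^n$. The tropical polytope generated by $v^1,\dots,v^p\in\mathbb{TP}^{n-1}$ is the set of all $x\in\mathbb{TP}^{n-1}$ (represented in $\mathbb{R}^n$) of the form $x_i=\max_{1\le r\le p}(\lambda_r+v^r_i)$ for $i=1,\dots,n$, with $\lambda_1,\dots,\lambda_p\in\mathbb{R}$. It is pure if it equals the closure of its interior in $\mathbb{TP}^{n-1}$. Tropical half-space: a set of the form $\{x\in\mathbb{TP}^{n-1}\mid \max_{i\in I}(c_i+x_i)\ge\max_{j\in J}(c_j+x_j)\}$, where $I,J$ is a partition of $\{1,\dots,n\}$ into two non-empty sets and $c_k\in\mathbb{R}$. General position: a square real matrix $U=(u_{ij})$ of size $m$ is tropically singular if the maximum $\max_{\sigma}(u_{1\sigma(1)}+\dots+u_{m\sigma(m)})$ over all permutations $\sigma$ of $\{1,\dots,m\}$ is attained by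 at least two permutations. Points $v^1,\dots,v^p$ of $\mathbb{TP}^{n-1}$ are in general position if every square submatrix of the $n\times p$ matrix with columns $v^1,\dots,v^p$ is tropically non-singular (this does not depend on the representatives). Hahn series: $\mathbb{K}$ is the field of real Hahn series $\boldsymbol{x}=\sum_{\alpha\in\mathbb{R}}x_\alpha t^\alpha$ ($x_\alpha\in\mathbb{R}$, with well-ordered support $\{\alpha\mid x_\alpha\ne0\}$). For $\boldsymbol{x}\neq 0$, let $\alpha_{\min}(\boldsymbol{x})$ be the least element of the support; the valuation is $\mathrm{val}(\boldsymbol{x})=-\alpha_{\min}(\boldsymbol{x})$, and $\mathrm{val}(0)=-\infty$. $\boldsymbol{x}$ is positive if $x_{\alpha_{\min}(\boldsymbol{x})}>0$; this makes $\mathbb{K}$ a totally ordered field, and $\mathbb{K}^+$ is the set of its positive elements. The map $\mathrm{val}$ is applied coordinate-wise to vectors. Lift: a lift of $\mathcal{P}$ is any polyhedral cone $\boldsymbol{P}=\mathrm{cone}(\{\boldsymbol{v}^1,\dots,\boldsymbol{v}^p\})\subset\mathbb{K}^n$ (conic hull over $\mathbb{K}$), where $\boldsymbol{v}^r\in(\mathbb{K}^+)^n$ satisfies $\mathrm{val}(\boldsymbol{v}^r)=v^r$ for each $r$. A facet-defining half-space of $\boldsymbol{P}$ is a half-space $\{\boldsymbol{x}\in\mathbb{K}^n\mid\sum_i\boldsymbol{f}_i\boldsymbol{x}_i\ge0\}$ containing $\boldsymbol{P}$ and whose bounding hyperplane meets $\boldsymbol{P}$ in a facet (a face of dimension $n-1$).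 The image under the valuation map of a half-space $\boldsymbol{H}\subset \mathbb{K}^n$ means the image of $\boldsymbol{H}\cap(\mathbb{K}^+)^n$ under $\mathrm{val}$, regarded in $\mathbb{TP}^{n-1}$. *)

(* Defs.v *)
From HB Require Import structures.
From mathcomp Require Import all_boot all_order all_algebra.
From mathcomp Require Import all_classical all_reals all_analysis.
From mathcomp Require Import perm lra.

Set Implicit Arguments.
Unset Strict Implicit.
Unset Printing Implicit Defensive.

Import Order.TTheory GRing.Theory Num.Theory.
Import numFieldNormedType.Exports.

Local Open Scope classical_set_scope.
Local Open Scope ring_scope.

Definition well_ordered (R : realType) (A : set R) : Prop :=
  forall B : set R, B `<=` A -> B !=set0 ->
    exists2 m, B m & forall b, B b -> m <= b.

Section WellOrdered.
Context {R : realType}.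
Implicit Types A B C : set R.

Lemma sub_well_ordered A B : A `<=` B -> well_ordered B -> well_ordered A.
Proof. by move=> AB wB C CA; apply: wB => x /CA /AB. Qed.

Lemma well_ordered_set1 (a : R) : well_ordered [set a].
Proof.
by move=> B Ba [b Bb]; exists b => // c Bc; rewrite (Ba _ Bb) (Ba _ Bc).
Qed.

Lemma well_orderedU A B :
  well_ordered A -> well_ordered B -> well_ordered (A `|` B).
Proof.
move=> wA wB C CAB C0.
have [CA|] := pselect (C `&` A !=set0); last first.
  move=> CA; apply: wB => // x Cx; have [Ax|//] := CAB x Cx.
  by case: CA; exists x.
have [CB|] := pselect (C `&` B !=set0); last first.
  move=> CB; apply: wA => // x Cx; have [//|Bx] := CAB x Cx.
  by case: CB; exists x.
have [a [Ca Aa] mina] := wA _ (@subIsetr _ C A) CA.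
have [b [Cb Bb] minb] := wB _ (@subIsetr _ C B) CB.
exists (Order.min a b); first by case: (leP a b).
move=> x Cx; rewrite ge_min; apply/orP.
by have [Ax|Bx] := CAB x Cx; [left; apply: mina|right; apply: minb].
Qed.

Definition sum_set A B : set R := [set c | exists a b, [/\ A a, B b & c = a + b]].

Lemma well_ordered_sum A B :
  well_ordered A -> well_ordered B -> well_ordered (sum_set A B).
Proof.
move=> wA wB C CAB [c0 Cc0].
pose D c := [set a | A a /\ exists b, [/\ B b, C (a + b) & a + b <= c]].
pose M c a := D c a /\ forall x, D c x -> a <= x.
have Mex c : C c -> exists a, M c a.
  move=> Cc; have [a [b [Aa Bb cE]]] := CAB _ Cc.
  have Da : D c a by split=> //; exists b; rewrite -cE.
  have DA : D c `<=` A by move=> ? [].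
  by have [m Dm mmin] := wA _ DA (ex_intro _ a Da); exists m.
pose E := [set b | exists c a, [/\ C c, M c a, B b, C (a + b) & a + b <= c]].
have EB : E `<=` B by move=> b [c [a []]].
have E0 : E !=set0.
  have [a Ma] := Mex _ Cc0; have [[Aa [b [Bb Cab abc]]] _] := Ma.
  by exists b, c0, a.
have [b [c [a [Cc Ma Bb Cab abc]]] bmin] := wB _ EB E0.
exists (a + b) => // c' Cc'; rewrite leNgt; apply/negP => c'lt.
have [a' Ma'] := Mex _ Cc'; have [[Aa' [b' [Bb' Cab' abc']]] _] := Ma'.
have bb' : b <= b' by apply: bmin; exists c', a'.
have aa' : a <= a'.
  apply: (proj2 Ma); split => //; exists b'; split => //.
  by rewrite (le_trans abc')// (le_trans (ltW c'lt)).
by have := lt_le_trans (le_lt_trans abc' c'lt) (lerD aa' bb'); rewrite ltxx.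
Qed.

Lemma well_ordered_finite A (c : R) :
  well_ordered A -> well_ordered [set c - a | a in A] -> finite_set A.
Proof.
move=> wA wcA.
have maxA C : C `<=` A -> C !=set0 -> exists2 m, C m & forall b, C b -> b <= m.
  move=> CA [x Cx].
  have [||_ [m Cm <-] mmin] := wcA [set c - a | a in C].
  - by move=> _ [a Ca <-]; exists a => //; apply: CA.
  - by exists (c - x), x.
  - exists m => // b Cb; have := mmin _ (ex_intro2 _ _ b Cb erefl).
    by rewrite lerD2l lerN2.
pose lo x := [set y | A y /\ y <= x].
apply: contrapT => infA.
have [|m [Am infm] mmin] := wA [set x | A x /\ ~ finite_set (lo x)]
    (fun x h => proj1 h).
  have [x Ax] : A !=set0.
    by apply: contrapT => A0; apply: infA; rewrite (_ : A = set0)//;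
       apply/seteqP; split => // x Ax; apply: A0; exists x.
  have [m Am mmax] := maxA _ (@subset_refl _ A) (ex_intro _ x Ax).
  exists m; split => // finm; apply: infA.
  by apply: sub_finite_set finm => y Ay; split => //; apply: mmax.
apply: infm.
have [lt0|lt0] := pselect ([set y | A y /\ y < m] !=set0); last first.
  apply: (sub_finite_set _ (finite_set1 m)) => y [Ay ym].
  apply/eqP; rewrite eq_le ym leNgt; apply/negP => ylt.
  by apply: lt0; exists y.
have [x [Ax xm] xmax] := maxA _ (fun x h => proj1 h) lt0.
apply: (@sub_finite_set _ _ (lo x `|` [set m])).
  move=> y [Ay]; rewrite le_eqVlt => /orP[/eqP->|ym]; first by right.
  by left; split => //; apply: xmax.
rewrite finite_setU; split => //.
apply: contrapT => infx; have := mmin x (conj Ax infx).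
by rewrite leNgt xm.
Qed.

End WellOrdered.
Arguments well_ordered_set1 {R} a.

Definition hsupp (R : realType) (f : R -> R) : set R := [set a | f a != 0].

Definition hahn_pred (R : realType) : {pred R -> R} :=
  [pred f | `[< well_ordered (hsupp f) >]].

(* coef x a is the coefficient of t^a in x. *)
Record hahn (R : realType) := Hahn {
  coef :> R -> R;
  _ : coef \in @hahn_pred R }.

HB.instance Definition _ (R : realType) := [isSub for @coef R].
HB.instance Definition _ (R : realType) := [Choice of hahn R by <:].

Lemma hahn_zmod_closed (R : realType) : zmod_closed (@hahn_pred R).
Proof.
split=> [|f g].
  by apply/asboolP => B B0 [b /B0]; rewrite /hsupp/= eqxx.
move=> /asboolP wf /asboolP wg; apply/asboolP.
apply: sub_well_ordered (well_orderedU wf wg) => a; rewrite /hsupp/=.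
rewrite -[(f - g) a]/(f a - g a).
have [->|fa0] := eqVneq (f a) 0; last by left.
by rewrite sub0r oppr_eq0; right.
Qed.
HB.instance Definition _ (R : realType) :=
  GRing.isZmodClosed.Build (R -> R) (@hahn_pred R) (@hahn_zmod_closed R).
HB.instance Definition _ (R : realType) :=
  [SubChoice_isSubZmodule of hahn R by <:].

Section Ring.
Context {R : realType}.
Implicit Types (f g h : R -> R) (x y z : hahn R).

Lemma hahnP x : well_ordered (hsupp x).
Proof. by apply/asboolP; case: x. Qed.
Arguments hahnP : clear implicits.

Definition mkhahn f (wf : well_ordered (hsupp f)) : hahn R :=
  Hahn (introT (asboolP (well_ordered (hsupp f))) wf).

Lemma hahn_ext x y : (forall a, x a = y a) -> x = y.
Proof. by move=> xy; apply: val_inj; apply: funext. Qed.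

Lemma coefD x y a : (x + y) a = x a + y a. Proof. by []. Qed.
Lemma coefN x a : (- x) a = - x a. Proof. by []. Qed.
Lemma coefB x y a : (x - y) a = x a - y a. Proof. by []. Qed.
Lemma coef0 a : (0 : hahn R) a = 0. Proof. by []. Qed.

(* For well-ordered supports the sum has finitely many nonzero terms
   (hconv_finite). *)
Definition hconv f g : R -> R := fun c => \sum_(a \in [set: R]) f a * g (c - a).

Lemma convE f g c (X : set R) :
  (forall a, f a != 0 -> g (c - a) != 0 -> X a) ->
  hconv f g c = \sum_(a \in X) f a * g (c - a).
Proof.
move=> hX; rewrite /hconv; apply/esym/fsbig_widen => // a [_ Xa] /=.
apply/eqP; apply: contrapT => /negP; rewrite mulf_eq0 negb_or => /andP[fa ga].
by apply: Xa; apply: hX.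
Qed.

Lemma hconv_finite f g c :
  well_ordered (hsupp f) -> well_ordered (hsupp g) ->
  finite_set [set a | f a != 0 /\ g (c - a) != 0].
Proof.
move=> wf wg; apply: (@well_ordered_finite _ _ c).
  by apply: sub_well_ordered wf => a [].
by apply: sub_well_ordered wg => _ [a [_ ga] <-].
Qed.

Lemma conv_support f g : hsupp (hconv f g) `<=` sum_set (hsupp f) (hsupp g).
Proof.
move=> c; rewrite /hsupp/= => cfg; apply: contrapT => nc.
move/eqP: cfg; apply; rewrite (@convE _ _ _ set0) ?fsbig_set0// => a fa ga.
by apply: nc; exists a, (c - a); split => //; rewrite addrC subrK.
Qed.

Lemma conv_well_ordered f g :
  well_ordered (hsupp f) -> well_ordered (hsupp g) ->
  well_ordered (hsupp (hconv f g)).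
Proof.
by move=> wf wg; apply: sub_well_ordered (well_ordered_sum wf wg); exact: conv_support.
Qed.

Definition hmul x y : hahn R := mkhahn (conv_well_ordered (hahnP x) (hahnP y)).

Definition mono_fun (k a : R) : R -> R := fun b => if b == a then k else 0.

Lemma mono_subproof k a : well_ordered (hsupp (mono_fun k a)).
Proof.
apply: sub_well_ordered (well_ordered_set1 a) => b.
by rewrite /hsupp /mono_fun /=; case: (eqVneq b a) => [->//|_]; rewrite eqxx.
Qed.

Arguments mono_subproof : clear implicits.

(* The monomial k t^a. *)
Definition hmono k a : hahn R := mkhahn (mono_subproof k a).

Lemma conv_monol k a g c : hconv (hmono k a) g c = k * g (c - a).
Proof.
rewrite (@convE _ _ _ [set a]) ?fsbig_set1 /= /mono_fun ?eqxx// => b.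
by rewrite /= /mono_fun; case: (eqVneq b a) => [->//|_]; rewrite eqxx.
Qed.

Lemma hmulC : commutative hmul.
Proof.
move=> x y; apply: hahn_ext => c; rewrite /= /hconv.
rewrite (reindex_fsbigT (fun a => c - a)).
  by apply: eq_fsbigr => a _; rewrite subKr mulrC.
by exists (fun a => c - a) => a; rewrite subKr.
Qed.

Lemma hmul1 : left_id (hmono 1 0) hmul.
Proof. by move=> x; apply: hahn_ext => c; rewrite /= conv_monol mul1r subr0. Qed.

Lemma hmulDl : left_distributive hmul +%R.
Proof.
move=> x y z; apply: hahn_ext => c; rewrite coefD /=.
pose X := [set a | x a != 0 /\ z (c - a) != 0] `|`
          [set a | y a != 0 /\ z (c - a) != 0].
have finX : finite_set X.
  by rewrite finite_setU; split; apply: hconv_finite; exact: hahnP.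
rewrite !(@convE _ _ _ X).
- rewrite -fsbig_split//=; apply: eq_fsbigr => a _; first by rewrite -mulrDl.
- by move=> a ya za; right.
- by move=> a xa za; left.
- move=> a; rewrite -[((x : R -> R) + y) a]/(x a + y a) => xya za.
  have [xa|xa] := eqVneq (x a) 0; [right|left]; split => //.
  by move: xya; rewrite xa add0r.
Qed.

Lemma hmulA : associative hmul.
Proof.
move=> x y z; apply: hahn_ext => d /=.
pose A := [set a | x a != 0 /\ sum_set (hsupp y) (hsupp z) (d - a)].
pose C := [set c | sum_set (hsupp x) (hsupp y) c /\ z (d - c) != 0].
have finA : finite_set A.
  apply: (@well_ordered_finite _ _ d).
    by apply: sub_well_ordered (hahnP x) => a [].
  apply: sub_well_ordered (well_ordered_sum (hahnP y) (hahnP z)).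
  by move=> _ [a [_ ?] <-].
have finC : finite_set C.
  apply: (@well_ordered_finite _ _ d).
    apply: sub_well_ordered (well_ordered_sum (hahnP x) (hahnP y)).
    by move=> a [].
  by apply: sub_well_ordered (hahnP z) => _ [a [_ ?] <-].
rewrite (@convE _ _ _ A); last by move=> a xa /conv_support.
rewrite (@convE _ _ _ C); last by move=> c /conv_support.
transitivity (\sum_(a \in A) \sum_(c \in C) x a * y (c - a) * z (d - c)).
  apply: eq_fsbigr => a; rewrite inE => -[xa _].
  rewrite (@convE _ _ _ [set c - a | c in C]).
    rewrite mulr_fsumr.
    rewrite fsbig_image//; last by move=> u v _ _ /addIr.
    apply: eq_fsbigr => c _.
    by rewrite mulrA opprB addrA subrK.
  move=> b yb zb; exists (a + b); last by rewrite addrAC subrr add0r.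
  by split; [exists a, b|rewrite opprD addrA].
rewrite exchange_fsbig//; apply: eq_fsbigr => c; rewrite inE => -[_ zc].
rewrite (@convE _ _ _ A).
  by rewrite mulr_fsuml.
move=> a xa ya; split => //; exists (c - a), (d - c); split => //.
by rewrite [RHS]addrC addrA subrK.
Qed.

End Ring.
Arguments hahnP {R} x.
Arguments mono_subproof {R} k a.

Lemma mono1_neq0 (R : realType) : hmono 1 0 != 0 :> hahn R.
Proof.
apply/eqP => /(congr1 (fun x : hahn R => x 0)).
by rewrite coef0 /= /mono_fun eqxx => /eqP; rewrite oner_eq0.
Qed.

HB.instance Definition _ (R : realType) :=
  GRing.Zmodule_isComNzRing.Build (hahn R)
    (@hmulA R) (@hmulC R) (@hmul1 R) (@hmulDl R) (@mono1_neq0 R).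

Section Field.
Context {R : realType}.
Implicit Types (x y z e : hahn R).

Lemma coefM x y c : (x * y) c = hconv x y c. Proof. by []. Qed.
Lemma coef1 a : (1 : hahn R) a = if a == 0 then 1 else 0. Proof. by []. Qed.

Definition least_exp x (m : R) := x m != 0 /\ forall a, x a != 0 -> m <= a.

Lemma least_exp_ex x : x != 0 -> exists m, least_exp x m.
Proof.
move=> x0; have [|m xm mmin] := hahnP x _ (@subset_refl _ _).
  apply: contrapT => h; move/eqP: x0; apply; apply: hahn_ext => a.
  by apply/eqP; apply: contrapT => /negP xa; apply: h; exists a.
by exists m.
Qed.

Lemma coef_lt_least x m a : least_exp x m -> a < m -> x a = 0.
Proof.
move=> [_ mmin] am; apply/eqP; apply: contrapT => /negP /mmin.
by rewrite leNgt am.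
Qed.

Lemma coefM_low x y (a b c : R) :
  (forall d, x d != 0 -> a <= d) -> (forall d, y d != 0 -> b <= d) ->
  (x * y) c != 0 -> a + b <= c.
Proof.
move=> xa yb /conv_support[u [v [xu yv ->]]].
by rewrite lerD// ?xa ?yb.
Qed.

Lemma coefM_least x y (a b : R) :
  least_exp x a -> least_exp y b -> (x * y) (a + b) = x a * y b.
Proof.
move=> [xa amin] [yb bmin]; rewrite coefM (@convE _ _ _ _ [set a]).
  by rewrite fsbig_set1 addrC addKr.
move=> u xu yu; apply/eqP; rewrite eq_le amin// andbT.
by have := bmin _ yu; lra.
Qed.

Lemma least_expM x y a b :
  least_exp x a -> least_exp y b -> least_exp (x * y) (a + b).
Proof.
move=> xa yb; split; last by move=> c; apply: coefM_low; [case: xa|case: yb].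
by rewrite coefM_least// mulf_neq0//; [case: xa|case: yb].
Qed.

(* The inverse of 1 - e, for e with support in [eps, +oo[, is the geometric
   series; its coefficient at c only involves the powers e^k with k eps <= c. *)
Section Geometric.
Context (e : hahn R) (eps : R).
Context (eps0 : 0 < eps) (heps : forall a, e a != 0 -> eps <= a).

Lemma coefX_low n c : (e ^+ n) c != 0 -> n%:R * eps <= c.
Proof.
elim: n c => [|n IHn] c.
  by rewrite expr0 coef1 mul0r; case: (eqVneq c 0) => [->//|_]; rewrite eqxx.
rewrite exprS => /(coefM_low heps IHn); lra.
Qed.

Definition geom n : hahn R := \sum_(k < n) e ^+ k.

Lemma geomS n : geom n.+1 = geom n + e ^+ n.
Proof. by rewrite /geom big_ord_recr. Qed.

Lemma geom_stable n m c : (n <= m)%N -> c < n%:R * eps -> geom m c = geom n c.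
Proof.
move=> /subnK <-; elim: (m - n)%N => [//|k IHk] cn.
rewrite addSn geomS coefD IHk//; set u := (e ^+ _) c.
suff -> : u = 0 by rewrite addr0.
apply/eqP; apply: contrapT => /negP /coefX_low; rewrite leNgt => /negP; apply.
by apply: lt_le_trans cn _; rewrite ler_pM2r// ler_nat leq_addl.
Qed.

Definition cutoff (c : R) : nat := (Num.truncn (c / eps)).+1.

Lemma cutoffP c : c < (cutoff c)%:R * eps.
Proof. by rewrite -ltr_pdivrMr// /cutoff truncnS_gt. Qed.

Lemma geom_cutoff n c : c < n%:R * eps -> geom n c = geom (cutoff c) c.
Proof.
move=> cn; have [nc|/ltnW nc] := leqP n (cutoff c).
  by rewrite -(geom_stable nc cn).
by rewrite (geom_stable nc (cutoffP c)).
Qed.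

Definition geom_lim_fun (c : R) : R := geom (cutoff c) c.

Lemma geom_lim_subproof : well_ordered (hsupp geom_lim_fun).
Proof.
move=> B Bg [b Bb].
have [||b' [Bb' b'b] bmin] := hahnP (geom (cutoff b)) (B `&` [set c | c <= b]).
- move=> c [Bc /= cb]; have := Bg _ Bc; rewrite /hsupp/= /geom_lim_fun.
  by rewrite (@geom_cutoff (cutoff b))//; apply: le_lt_trans cb (cutoffP b).
- by exists b; split => /=.
exists b' => // c Bc; have [cb|/ltW bc] := leP c b; first by apply: bmin.
exact: le_trans bc.
Qed.

Definition geom_lim : hahn R := mkhahn geom_lim_subproof.

Lemma geom_limP : (1 - e) * geom_lim = 1.
Proof.
apply: hahn_ext => c; pose n := cutoff c.
have low a : (1 - e) a != 0 -> 0 <= a.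
  rewrite coefB coef1; case: (eqVneq a 0) => [->//|_].
  by rewrite sub0r oppr_eq0 => /heps; apply: le_trans; apply: ltW.
transitivity (((1 - e) * geom n) c).
  rewrite !coefM; apply: eq_fsbigr => a _.
  have [->|/low a0] := eqVneq ((1 - e) a) 0; first by rewrite !mul0r.
  congr (_ * _); rewrite /= /geom_lim_fun; apply/esym/geom_cutoff.
  by apply: le_lt_trans (cutoffP c); rewrite gerBl.
have -> : (1 - e) * geom n = 1 - e ^+ n by rewrite -[RHS]opprB subrX1 -mulNr opprB.
rewrite coefB; suff -> : (e ^+ n) c = 0 by rewrite subr0.
apply/eqP; apply: contrapT => /negP /coefX_low.
by rewrite leNgt cutoffP.
Qed.

End Geometric.

Lemma hahn_inv_ex x : x != 0 -> exists y, y * x = 1.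
Proof.
move=> /least_exp_ex[m [xm mmin]].
pose e : hahn R := 1 - hmono (x m)^-1 (- m) * x.
have ea a : e a = (if a == 0 then 1 else 0) - (x m)^-1 * x (a + m).
  by rewrite coefB coef1 coefM conv_monol opprK.
have e0 a : e a != 0 -> 0 < a.
  rewrite ea; case: (eqVneq a 0) => [->|a0].
    by rewrite add0r mulVf// subrr eqxx.
  rewrite sub0r oppr_eq0 mulf_eq0 negb_or => /andP[_ /mmin].
  by rewrite lerDr lt_def a0.
have [eps eps0 heps] : exists2 eps : R, 0 < eps & forall a, e a != 0 -> eps <= a.
  have [->|] := eqVneq e 0; first by exists 1 => // a; rewrite coef0 eqxx.
  by move=> /least_exp_ex[eps [/e0 ? ?]]; exists eps.
exists (geom_lim eps0 heps * hmono (x m)^-1 (- m)).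
have := geom_limP eps0 heps; rewrite {1}/e opprB addrC subrK => <-.
by rewrite [RHS]mulrC mulrA.
Qed.

Definition hinv x : hahn R := xget 0 [set y | x != 0 /\ y * x = 1].

Lemma hmulVx x : x != 0 -> hinv x * x = 1.
Proof.
move=> x0; have [y yx] := hahn_inv_ex x0.
have /(_ (ex_intro _ y (conj x0 yx))) :=
  @xgetPex _ 0 [set y | x != 0 /\ y * x = 1].
by case.
Qed.

Lemma hinv0 : hinv 0 = 0.
Proof. by rewrite /hinv; case: xgetP => // y _ [/eqP]. Qed.

End Field.

HB.instance Definition _ (R : realType) :=
  GRing.ComNzRing_isField.Build (hahn R) (@hmulVx R) (@hinv0 R).

Section Order.
Context {R : realType}.
Implicit Types x y : hahn R.

(* The value at the zero series is junk. *)
Definition alpha_min x : R := xget 0 [set m | least_exp x m].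

Lemma alpha_minP x : x != 0 -> least_exp x (alpha_min x).
Proof. by move=> /least_exp_ex xm; exact: xgetPex. Qed.

Lemma least_exp_uniq x a b : least_exp x a -> least_exp x b -> a = b.
Proof.
by move=> [xa amin] [xb bmin]; apply/eqP; rewrite eq_le amin// bmin.
Qed.

Lemma alpha_minE x m : least_exp x m -> alpha_min x = m.
Proof.
move=> xm; apply: (least_exp_uniq _ xm); apply: alpha_minP.
by apply/eqP => x0; case: xm; rewrite x0 coef0 eqxx.
Qed.

Definition hval x : \bar R := if x == 0 then -oo%E else (- alpha_min x)%:E.

Definition hpos x : bool := 0 < x (alpha_min x).

Lemma hposP x : reflect (exists2 m, least_exp x m & 0 < x m) (hpos x).
Proof.
apply: (iffP idP) => [xp|[m /alpha_minE <-]//].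
exists (alpha_min x) => //; apply: alpha_minP.
by apply/eqP => x0; move: xp; rewrite /hpos x0 coef0 ltxx.
Qed.

Definition hlt x y := hpos (y - x).
Definition hle x y := (x == y) || hlt x y.
Definition hnorm x := if hpos x then x else - x.

Lemma hposD x y : hpos x -> hpos y -> hpos (x + y).
Proof.
move=> /hposP[a xa xpos] /hposP[b yb ypos]; apply/hposP.
have [ab|ba|ab] := ltgtP a b.
- exists a; last by rewrite coefD (coef_lt_least yb ab) addr0.
  split; first by rewrite coefD (coef_lt_least yb ab) addr0; case: xa.
  move=> c; apply: contraNle => ca.
  by rewrite coefD (coef_lt_least xa ca) (coef_lt_least yb (lt_trans ca ab)) addr0.
- exists b; last by rewrite coefD (coef_lt_least xa ba) add0r.
  split; first by rewrite coefD (coef_lt_least xa ba) add0r; case: yb.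
  move=> c; apply: contraNle => cb.
  by rewrite coefD (coef_lt_least yb cb) (coef_lt_least xa (lt_trans cb ba)) addr0.
- subst b; exists a; last by rewrite coefD addr_gt0.
  split; first by rewrite coefD gt_eqF// addr_gt0.
  move=> c; apply: contraNle => ca.
  by rewrite coefD (coef_lt_least xa ca) (coef_lt_least yb ca) addr0.
Qed.

Lemma hposM x y : hpos x -> hpos y -> hpos (x * y).
Proof.
move=> /hposP[a xa xpos] /hposP[b yb ypos]; apply/hposP.
by exists (a + b); [exact: least_expM|rewrite coefM_least// mulr_gt0].
Qed.

Lemma hpos0 : hpos (0 : hahn R) = false.
Proof. by rewrite /hpos coef0 ltxx. Qed.

Lemma hposN x : hpos x -> ~~ hpos (- x).
Proof. by move=> xp; apply/negP => /(hposD xp); rewrite subrr hpos0. Qed.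

Lemma hpos_total x : x != 0 -> hpos x || hpos (- x).
Proof.
move=> /least_exp_ex[m xm]; have [xm0 mmin] := xm.
have Nxm : least_exp (- x) m.
  by split=> [|a]; rewrite coefN oppr_eq0//; exact: mmin.
have [lt0|gt0|/eqP] := ltgtP (x m) 0; last by rewrite (negbTE xm0).
- by apply/orP; right; apply/hposP; exists m => //; rewrite coefN oppr_gt0.
- by apply/orP; left; apply/hposP; exists m.
Qed.

Fact hlt0_add x y : hlt 0 x -> hlt 0 y -> hlt 0 (x + y).
Proof. by rewrite /hlt !subr0; exact: hposD. Qed.
Fact hlt0_mul x y : hlt 0 x -> hlt 0 y -> hlt 0 (x * y).
Proof. by rewrite /hlt !subr0; exact: hposM. Qed.
Fact hlt0_ngt0 x : hlt 0 x -> ~~ hlt x 0.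
Proof. by rewrite /hlt subr0 sub0r; exact: hposN. Qed.
Fact hsub_gt0 x y : hlt 0 (y - x) = hlt x y.
Proof. by rewrite /hlt subr0. Qed.
Fact hlt0_total x : x != 0 -> hlt 0 x || hlt x 0.
Proof. by rewrite /hlt subr0 sub0r; exact: hpos_total. Qed.
Fact hnormN x : hnorm (- x) = hnorm x.
Proof.
rewrite /hnorm opprK; have [->|x0] := eqVneq x 0; first by rewrite oppr0 hpos0.
have := hpos_total x0; case: (boolP (hpos x)) => [xp _|_ /= ->//].
by rewrite (negbTE (hposN xp)).
Qed.
Fact hge0_norm x : hle 0 x -> hnorm x = x.
Proof.
rewrite /hle /hlt subr0 /hnorm => /orP[/eqP<-|->//].
by rewrite hpos0 oppr0.
Qed.

End Order.

HB.instance Definition _ (R : realType) :=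
  Num.IntegralDomain_isLtReal.Build (hahn R)
    (@hlt0_add R) (@hlt0_mul R) (@hlt0_ngt0 R) (@hsub_gt0 R) (@hlt0_total R)
    (@hnormN R) (@hge0_norm R) (fun _ _ => erefl).

Lemma hahn_gt0 (R : realType) (x : hahn R) : (0 < x) = (0 < x (alpha_min x)).
Proof. by rewrite -[LHS]/(hpos (x - 0)) subr0. Qed.

Lemma hval_fin_num (R : realType) (x : hahn R) : 0 < x -> hval x \is a fin_num.
Proof. by move=> /lt0r_neq0 /negbTE x0; rewrite /hval x0. Qed.

Section TropicalProjectiveSpace.
Context (R : realType) (n : nat).

Definition tp_rel (x y : 'rV[R]_n) : bool :=
  `[< exists c : R, forall i, x 0 i = y 0 i + c >].

Lemma tp_rel_refl : reflexive tp_rel.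
Proof. by move=> x; apply/asboolP; exists 0 => i; rewrite addr0. Qed.

Lemma tp_rel_sym : symmetric tp_rel.
Proof.
move=> x y; apply/asboolP/asboolP => -[c xy]; exists (- c) => i.
  by rewrite xy addrK.
by rewrite xy addrK.
Qed.

Lemma tp_rel_trans : transitive tp_rel.
Proof.
move=> y x z /asboolP[c xy] /asboolP[d yz]; apply/asboolP.
by exists (d + c) => i; rewrite xy yz addrA.
Qed.

Canonical tp_equiv := EquivRel tp_rel tp_rel_refl tp_rel_sym tp_rel_trans.

(* R^n / R(1,...,1) with the quotient topology, a space of dimension n - 1. *)
Definition TP : Type := quotient_topology {eq_quot tp_equiv}%qT.

HB.instance Definition _ := Topological.on TP.
HB.instance Definition _ := Quotient.on TP.

End TropicalProjectiveSpace.

Definition tp_pi (R : realType) (n : nat) (x : 'rV[R]_n) : TP R n :=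
  (\pi_(TP R n) x)%qT.

Definition tp_repr (R : realType) (n : nat) (x : TP R n) : 'rV[R]_n := repr x.

Lemma tp_reprK (R : realType) (n : nat) : cancel (@tp_repr R n) (@tp_pi R n).
Proof. exact: reprK. Qed.

Lemma tp_piP (R : realType) (n : nat) (x y : 'rV[R]_n) :
  tp_pi x = tp_pi y <-> exists c : R, forall i, x 0 i = y 0 i + c.
Proof.
rewrite /tp_pi; split => [/eqmodP/asboolP//|h].
by apply/eqmodP/asboolP.
Qed.

Section Tropical.
Context (R : realType) (n p : nat).
Implicit Types (v : 'I_p -> TP R n).

Definition tropical_polytope v : set (TP R n) :=
  @tp_pi R n @` [set x : 'rV[R]_n | exists lambda : 'I_p -> R, forall i,
    (x 0 i)%:E = \big[Order.max/-oo%E]_(r < p) (lambda r + tp_repr (v r) 0 i)%:E].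

Definition pure (A : set (TP R n)) : Prop := A = closure (interior A).

Definition tropical_halfspace (H : set (TP R n)) : Prop :=
  exists (I J : {set 'I_n}) (c : 'I_n -> R),
    [/\ I != finset.set0 /\ J != finset.set0,
        (I :|: J = [set: 'I_n])%SET, (I :&: J)%SET = finset.set0 &
        H = @tp_pi R n @` [set x : 'rV[R]_n |
          (\big[Order.max/-oo]_(j in J) (c j + x 0 j)%:E <=
           \big[Order.max/-oo]_(i in I) (c i + x 0 i)%:E)%E]].

Definition tropically_singular (m : nat) (U : 'M[R]_m) : Prop :=
  exists s t : 'S_m, s != t /\
    forall r : 'S_m,
      \sum_(i < m) U i (r i) <= \sum_(i < m) U i (s i) /\
      \sum_(i < m) U i (r i) <= \sum_(i < m) U i (t i).

Definition general_position v : Prop :=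
  forall (m : nat) (f : 'I_m -> 'I_n) (g : 'I_m -> 'I_p),
    (forall i j : 'I_m, (i < j)%N -> (f i < f j)%N) ->
    (forall i j : 'I_m, (i < j)%N -> (g i < g j)%N) ->
    ~ tropically_singular
        (mxsub f g (\matrix_(i < n, r < p) tp_repr (v r) 0 i)).

End Tropical.

Section Lift.
Context (R : realType) (n p : nat).
Implicit Types (v : 'I_p -> TP R n) (w : 'I_p -> 'rV[hahn R]_n).
Implicit Types (P H : set 'rV[hahn R]_n).

Definition positive_vec (x : 'rV[hahn R]_n) : Prop := forall i, 0 < x 0 i.

(* Only meaningful on positive vectors, where every valuation is finite
   (hval_fin_num). *)
Definition hvalv (x : 'rV[hahn R]_n) : 'rV[R]_n := \row_i fine (hval (x 0 i)).

Definition conic_hull w : set 'rV[hahn R]_n :=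
  [set x | exists mu : 'I_p -> hahn R,
    (forall r, 0 <= mu r) /\ x = \sum_(r < p) mu r *: w r].

(* The condition hvalv (w r) = v r is taken in TP: rescaling w r by a power of t
   adjusts its valuation to any representative without changing the cone. *)
Definition is_lift v P : Prop :=
  exists w, [/\ forall r, positive_vec (w r), forall r, tp_pi (hvalv (w r)) = v r &
                P = conic_hull w].

Definition lin_form (f x : 'rV[hahn R]_n) : hahn R := \sum_i f 0 i * x 0 i.

(* The dimension of the linear span, which for a set containing 0 (such as a
   face of a cone) is the affine span. *)
Definition has_dim (S : set 'rV[hahn R]_n) (d : nat) : Prop :=
  exists U : {vspace 'rV[hahn R]_n},
    [/\ S `<=` [set x | x \in U],
        forall W : {vspace 'rV[hahn R]_n}, S `<=` [set x | x \in W] -> (U <= W)%VS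
      & \dim U = d].

Definition facet_halfspace P : set (set 'rV[hahn R]_n) :=
  [set H | exists f : 'rV[hahn R]_n,
    [/\ f != 0, H = [set x | 0 <= lin_form f x], P `<=` H &
        has_dim (P `&` [set x | lin_form f x = 0]) n.-1]].

Definition val_image H : set (TP R n) :=
  [set tp_pi (hvalv x) | x in H `&` [set x | positive_vec x]].

Definition facets_tropicalize v P : Prop :=
  (forall H, facet_halfspace P H -> tropical_halfspace (val_image H)) /\
  \bigcap_(H in facet_halfspace P) val_image H = tropical_polytope v.

End Lift.

(* Main.v *)
Require Import Defs.
From mathcomp Require Import all_boot all_order all_algebra.
From mathcomp Require Import all_classical all_reals all_analysis.
From mathcomp Require Import fintype finset perm lra zify ring.

(** Let V be the matrix of valuations of the generators of a lift. The generator
    r touches a point y at the coordinates where V r - y is maximal; y is in the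
    polytope iff every coordinate is touched. Purity says that at every point of
    the polytope the unions of touched sets form an antimatroid: each nonempty one
    can be shrunk by one element ([pure_accessible]).

    Given x outside the polytope, choose y in it such that the set S of maximizers
    of x - y contains no touched set and is as small as possible. After a small
    move of y, some generator touches y exactly at a coordinate i, and S is covered
    by sets touched within i and S ([sep_point]). Over the reals, the cone spanned
    by the leading coefficients of the generators, restricted to the coordinates
    they touch, then has supporting hyperplanes whose normal vectors are negative
    on S, and a suitable point outside the cone forces this sign
    ([residue_separation]). Lifted to Hahn series, this point is separated from the
    cone by a facet, and the facet inherits the signs, which excludes x from the
    image of its half-space.

    This only uses that two elements of S touched by the same generator do not both
    have large leading coefficients ([leads_dominated]). In general position no
    generator touches two elements of S. Otherwise, the leading coefficients are
    chosen as exp (N h) for a height h that measures how far a generator is from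
    being extreme at a coordinate, and a generic higher order term makes all facet
    normals have nonzero coordinates. *)

Set Implicit Arguments.
Unset Strict Implicit.
Unset Printing Implicit Defensive.

Import Order.TTheory GRing.Theory Num.Theory.
Import numFieldNormedType.Exports.

Local Open Scope ring_scope.

(** * Touched coordinates *)

Lemma finite_pos_lb (R : realFieldType) (I : finType) (P : pred I) (F : I -> R) :
  (forall i, P i -> 0 < F i) -> exists2 e, 0 < e & forall i, P i -> e <= F i.
Proof.
move=> F0; exists (\big[Order.min/1]_(i | P i) F i).
  by apply: lt_bigmin => //; exact: ltr01.
by move=> i Pi; exact: bigmin_le_cond.
Qed.

Lemma exists_argmax (R : realFieldType) (I : finType) (i0 : I) (P : pred I)
    (F : I -> R) :
  P i0 -> exists2 i, P i & forall j, P j -> F j <= F i.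
Proof. by move=> Pi0; case: (arg_maxP F Pi0) => i Pi im; exists i. Qed.

Lemma mem_subU1 (T : finType) (i : T) (A S : {set T}) :
  A \subset i |: S -> ~~ (A \subset S) -> i \in A.
Proof.
move=> AiS; apply: contraNT => iA; apply/subsetP => j jA.
have := subsetP AiS j jA; rewrite in_setU1 => /orP[/eqP ji|//].
by rewrite ji (negbTE iA) in jA.
Qed.

Lemma notin_subU1 (T : finType) (i : T) (A S : {set T}) :
  A \subset i |: S -> ~~ (A \subset S) -> i \notin S.
Proof.
move=> AiS; apply: contra => iS; apply: subset_trans AiS _.
by rewrite subUset sub1set iS subxx.
Qed.

Section Tops.
Context (R : realFieldType) (n p : nat).
Implicit Types (V : 'I_p -> 'I_n -> R) (x y d : 'I_n -> R) (B C S : {set 'I_n}).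

Definition top V x r := [set i | [forall j, V r j - x j <= V r i - x i]].

Definition covered V x := forall i, exists r, i \in top V x r.

(** These are the unions of touched sets, written elementwise. *)
Definition feasible V x B :=
  forall i, i \in B -> exists r, i \in top V x r /\ top V x r \subset B.

(** The accessibility axiom of an antimatroid; closure under unions is automatic for [feasible]. *)
Definition accessible V := forall x B, covered V x -> feasible V x B ->
  B != set0 -> exists2 b, b \in B & feasible V x (B :\ b).

Lemma topP V x r i :
  reflect (forall j, V r j - x j <= V r i - x i) (i \in top V x r).
Proof. by rewrite inE; exact: forallP. Qed.

Lemma top_eq V x r i j : i \in top V x r -> j \in top V x r ->
  V r i - x i = V r j - x j.
Proof. by move=> /topP ir /topP jr; apply/eqP; rewrite eq_le ir jr. Qed.

Lemma top_exists V x r (i0 : 'I_n) : exists i, i \in top V x r.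
Proof.
have [i _ im] := exists_argmax (i0 := i0) (P := xpredT) (fun i => V r i - x i) isT.
by exists i; apply/topP => j; exact: im.
Qed.

Lemma eq_top V x y r : x =1 y -> top V x r = top V y r.
Proof. by move=> xy; apply/setP => i; apply/topP/topP => h j; move: (h j); rewrite !xy. Qed.

(** Coordinates outside the touched set lag by at least [2 * e], which a perturbation below [e]
    cannot make up. On the touched set [V r - x] is constant, so [d] alone decides. *)
Lemma top_perturb V x : exists2 e, 0 < e &
  forall d, (forall i, `|d i| < e) -> forall r i,
  (i \in top V (fun j => x j + d j) r) =
  (i \in top V x r) && [forall (j | j \in top V x r), d i <= d j].
Proof.
have [|e e0 he] := @finite_pos_lb R ('I_p * 'I_n * 'I_n)%type
  [pred t | (t.1.2 \in top V x t.1.1) && (t.2 \notin top V x t.1.1)]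
  (fun t => ((V t.1.1 t.1.2 - x t.1.2) - (V t.1.1 t.2 - x t.2)) / 2).
  move=> [[r i] j] /= /andP[/topP ir /negP jr]; rewrite divr_gt0// subr_gt0.
  rewrite ltNge; apply/negP => ji; apply: jr; apply/topP => k.
  exact: le_trans (ir k) ji.
have gap r i j : i \in top V x r -> j \notin top V x r ->
    V r j - x j + 2 * e <= V r i - x i.
  move=> ir jr; have := he (r, i, j); rewrite /= ir jr => /(_ isT).
  by lra.
exists e => // d de r i.
have db j k : d j - d k < 2 * e.
  have := ler_norm (d j); have := ler_norm (- d k); rewrite normrN.
  by have := de j; have := de k; lra.
apply/topP/andP => [h|[ir /forall_inP dm] j]; last first.
  have [jr|jr] := boolP (j \in top V x r).
    by have := top_eq ir jr; have := dm j jr; lra.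
  by have := gap _ _ _ ir jr; have := db i j; lra.
have ir : i \in top V x r.
  apply: contrapT => /negP ir; have [k kr] := top_exists V x r i.
  by have := gap _ _ _ kr ir; have := h k; have := db k i; lra.
split=> //; apply/forall_inP => j jr.
by have := h j; have := top_eq ir jr; lra.
Qed.

Definition raise x e C : 'I_n -> R := fun j => x j + (if j \in C then e else 0).

(** A touched set inside [C] is shifted uniformly and survives; any other keeps an unraised
    maximizer and loses its part in [C]. Feasibility of [C] keeps the raised coordinates covered. *)
Lemma feasible_raise V x C (e0 : R) : covered V x -> feasible V x C -> 0 < e0 ->
  exists e, [/\ 0 < e, e < e0, covered V (raise x e C) &
    forall r, top V (raise x e C) r =
      if top V x r \subset C then top V x r else top V x r :\: C].
Proof.
move=> xc Cf e00; have [e1 e10 he] := top_perturb V x.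
pose e := Num.min e0 e1 / 2.
have m0 : 0 < Num.min e0 e1 by rewrite lt_min e00 e10.
have e_gt0 : 0 < e by rewrite divr_gt0.
have em : e < Num.min e0 e1 by rewrite /e; lra.
move: (em); rewrite lt_min => /andP[ee0 ee1].
have te r : top V (raise x e C) r =
      if top V x r \subset C then top V x r else top V x r :\: C.
  apply/setP => i; rewrite he; last first.
    by move=> j; case: ifP; rewrite ?normr0// gtr0_norm.
  case: (boolP (top V x r \subset C)) => [/subsetP rC|/subsetPn[k kr kC]];
    last rewrite in_setD andbC.
    case: (boolP (i \in top V x r)) => //= ir; apply/forall_inP => j jr.
    by rewrite !rC.
  congr (_ && _); apply/forall_inP/idP => [/(_ k kr)|iC j jr].
    by rewrite (negbTE kC); case: ifP => // _; lra.
  by rewrite (negbTE iC); case: ifP => // _; lra.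
exists e; split => // i.
have [iC|iC] := boolP (i \in C).
  by have [r [ir rC]] := Cf i iC; exists r; rewrite te rC.
have [r ir] := xc i; exists r; rewrite te.
by case: ifPn => // _; rewrite in_setD iC.
Qed.

(** Accessibility removes elements of [B] one at a time; when the first of [k] and [l] goes, the
    other is still there. *)
Lemma feasible_separates V x : accessible V -> covered V x ->
  forall B, feasible V x B -> forall k l, k \in B -> l \in B -> k != l ->
  exists A, [/\ feasible V x A, A \subset B & (k \in A) (+) (l \in A)].
Proof.
move=> acc xc B; move: {2}#|B| (leqnn #|B|) => m.
elim: m B => [|m IH] B.
  by rewrite leqn0 cards_eq0 => /eqP-> _ k l; rewrite inE.
move=> Bm Bf k l kB lB kl.
have [|b bB bf] := acc _ _ xc Bf; first by apply/set0Pn; exists k.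
have [kb|bk] := eqVneq k b.
  by subst b; exists (B :\ k); split; [|exact: subD1set|rewrite !inE eqxx [l == k]eq_sym kl lB].
have [lb|bl] := eqVneq l b.
  by subst b; exists (B :\ l); split; [|exact: subD1set|rewrite !inE eqxx kB kl].
have [||||A [Af AB Akl]] := IH (B :\ b) _ bf k l.
- by move: Bm; rewrite (cardsD1 b B) bB.
- by rewrite !inE bk.
- by rewrite !inE bl.
- exact: kl.
by exists A; split; [exact: Af|exact: subset_trans AB (subD1set _ _)|exact: Akl].
Qed.


(** This is the tropical projection onto the polytope: [la r] is the largest scalar with
    [la r + V r] below [x], and [y] is the maximum of these translates. Where [la r] is tight, [y]
    meets [x] and [r] touches [y]. *)
Lemma project V x : (0 < p)%N -> (0 < n)%N -> exists y, [/\ covered V y,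
  forall j, y j <= x j & forall r, exists2 j, j \in top V y r & y j = x j].
Proof.
move=> p0 n0; pose r0 := Ordinal p0; pose i0 := Ordinal n0.
have /choice[la laP] : forall r, exists la, (forall j, la <= x j - V r j) /\
    exists j, la = x j - V r j.
  move=> r; have [i /topP ir] := top_exists V x r i0.
  by exists (x i - V r i); split; [move=> j; have := ir j; lra|exists i].
have /choice[rho rhoP] : forall j, exists r, forall s,
    la s + V s j <= la r + V r j.
  move=> j; have [r _ rm] := @exists_argmax R _ r0 xpredT (fun s => la s + V s j) isT.
  by exists r => s; exact: rm.
pose y j := la (rho j) + V (rho j) j.
have tope r j : y j = la r + V r j -> j \in top V y r.
  by move=> yj; apply/topP => k; rewrite yj; have := rhoP k r; rewrite /y; lra.
have yx j : y j <= x j by have := (laP (rho j)).1 j; rewrite /y; lra.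
exists y; split => [j|//|r].
  by exists (rho j); exact: tope.
have [_ [j laj]] := laP r; have yj : y j = x j.
  by have := yx j; have := rhoP j r; rewrite /y laj; lra.
by exists j => //; apply: tope; rewrite yj laj subrK.
Qed.

(** * Points of the polytope chosen relative to an outside point *)

Definition argmaxs x y : {set 'I_n} := [set k | [forall j, x j - y j <= x k - y k]].

Lemma argmaxsP x y k : reflect (forall j, x j - y j <= x k - y k) (k \in argmaxs x y).
Proof. by rewrite inE; exact: forallP. Qed.

Lemma argmaxs_lt x y k j : k \in argmaxs x y -> j \notin argmaxs x y ->
  x j - y j < x k - y k.
Proof.
move=> /argmaxsP km; rewrite ltNge; apply: contra => kj.
by apply/argmaxsP => i; exact: le_trans (km i) kj.
Qed.

Lemma argmaxs_neq0 x y (i0 : 'I_n) : argmaxs x y != set0.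
Proof.
have [i _ im] := exists_argmax (i0 := i0) (P := xpredT) (fun i => x i - y i) isT.
by apply/set0Pn; exists i; apply/argmaxsP => j; exact: im.
Qed.

(* Raising [y] on a set that misses some of the maximizers of [x - y] removes
   from the maximizers exactly the raised ones. *)
Lemma argmaxs_raise x y e C : 0 < e -> ~~ (argmaxs x y \subset C) ->
  argmaxs x (raise y e C) = argmaxs x y :\: C.
Proof.
move=> e0 /subsetPn[k kS kC]; apply/setP => l; rewrite in_setD.
apply/argmaxsP/andP => [h|[lC lS] j]; last first.
  have /argmaxsP/(_ j) := lS; rewrite /raise (negbTE lC).
  by case: ifP; lra.
have lC : l \notin C.
  apply/negP => lC; have := h k; rewrite /raise lC (negbTE kC).
  by move/argmaxsP: kS => /(_ l); lra.
split=> //; apply/argmaxsP => j.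
have := h k; rewrite /raise (negbTE lC) (negbTE kC).
by move/argmaxsP: kS => /(_ j); lra.
Qed.

Let valid V x y := covered V y /\ forall r, ~~ (top V y r \subset argmaxs x y).

Lemma exists_valid V x : (0 < p)%N -> (0 < n)%N -> ~ covered V x ->
  exists y, valid V x y.
Proof.
move=> p0 n0 xc; have [y [yc yx yt]] := project V x p0 n0.
exists y; split => // r; apply/subsetPn.
have [j jr yj] := yt r; exists j => //; apply/negP => /argmaxsP jm.
(* The maximum of [x - y] would be 0; as [y] lies below [x], they would coincide and [x] would be
   covered. *)
apply: xc; have yxe i : y i = x i by have := jm i; have := yx i; lra.
by move=> i; have [s si] := yc i; exists s; rewrite -(@eq_top V y).
Qed.

(** Take a smallest feasible set that misses [S] but together with [S] contains the touched set of a
    generator touching [S]. Accessibility removes one element [i] from it. *)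
Lemma exists_entering V y S : accessible V -> covered V y ->
  S != set0 -> (forall r, ~~ (top V y r \subset S)) ->
  exists A i r, [/\ feasible V y A, i \notin A, i \notin S & [disjoint A & S]] /\
    [/\ feasible V y (i |: A), ~~ [disjoint top V y r & S],
        top V y r \subset i |: A :|: S &
        forall s, top V y s \subset A :|: S -> top V y s \subset A].
Proof.
move=> acc yc S0 yS.
pose Q A := [/\ feasible V y A, [disjoint A & S] &
  exists r, ~~ [disjoint top V y r & S] /\ top V y r \subset A :|: S].
(* Shrink the whole set by accessibility until it misses [S]. The last element removed lies in [S],
   and a generator touching it within the previous set is the required one. *)
have [A QA] : exists A, Q A.
  have : exists B, feasible V y B /\ ~~ [disjoint B & S].
    exists [set: 'I_n]; split; first by move=> i _; have [r ir] := yc i; exists r.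
    rewrite -setI_eq0 setTI //.
  case=> B; move: {2}#|B| (leqnn #|B|) => m; elim: m B => [|m IH] B Bm [Bf BS].
    case/negP: BS; move: Bm; rewrite leqn0 cards_eq0 => /eqP->.
    by rewrite -setI_eq0 set0I.
  have [|b bB bf] := acc _ _ yc Bf.
    by apply: contraNneq BS => ->; rewrite -setI_eq0 set0I.
  have [BbS|/(conj bf)/(IH (B :\ b))] := boolP [disjoint B :\ b & S]; last first.
    by apply; move: Bm; rewrite (cardsD1 b B) bB.
  have bS : b \in S.
    apply: contraNT BS => bS; rewrite -(setD1K bB) -setI_eq0 setIUl.
    move: BbS; rewrite -setI_eq0 => /eqP->; rewrite setU0 setI_eq0.
    by rewrite disjoints1.
  exists (B :\ b); split => //; have [r [br rB]] := Bf b bB; exists r; split.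
    by rewrite -setI_eq0; apply/set0Pn; exists b; rewrite inE br.
  apply: subset_trans rB _; apply/subsetP => j jB; rewrite !inE jB.
  by case: eqVneq => // ->.
have [m [A' [QA' A'm]] mmin] : exists2 m, (exists A, Q A /\ #|A| = m) &
    forall A, Q A -> (m <= #|A|)%N.
  have ex : exists m, `[< exists A, Q A /\ #|A| = m >].
    by exists #|A|; apply/asboolP; exists A.
  exists (ex_minn ex); case: ex_minnP => m /asboolP // h hm B QB.
  by apply: hm; apply/asboolP; exists B.
have [A'f A'S [r [rS rA']]] := QA'.
have [|i iA' if'] := acc _ _ yc A'f.
  apply: contraNneq (yS r) => A'0; move: rA'.
  by rewrite A'0 set0U.
have dis : [disjoint A' :\ i & S] := disjointWl (subD1set _ _) A'S.
exists (A' :\ i), i, r; split; split => //.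
- by rewrite !inE eqxx.
- by apply/negP => iS; move/pred0P: A'S => /(_ i); rewrite /= iA' iS.
- by rewrite setD1K.
- by rewrite setD1K.
(* If [s] touched [S], the set without [i] would satisfy [Q], against minimality. *)
move=> s sA; have [sS|sS] := boolP [disjoint top V y s & S].
  apply/subsetP => j js; move/subsetP: sA => /(_ j js).
  rewrite in_setU => /orP[//|jS].
  by move/pred0P: sS => /(_ j); rewrite /= js jS.
have /mmin : Q (A' :\ i) by split => //; exists s.
by rewrite -A'm (cardsD1 i A') iA' ltnn.
Qed.

(** Start from a valid [y] with the fewest maximizers. Raising it on the entering set isolates [i]
    for one generator; if [S] were then not covered from within [i |: S], a second raise would lose
    maximizers. *)
Lemma sep_point V x : accessible V -> (0 < p)%N -> (0 < n)%N -> ~ covered V x ->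
  exists y i (S := argmaxs x y), [/\ covered V y,
    forall r, ~~ (top V y r \subset S),
    exists r, top V y r = [set i]%SET &
    forall k, k \in S -> exists r, k \in top V y r /\ top V y r \subset i |: S].
Proof.
move=> acc p0 n0 xc; have [y0 y0v] := exists_valid p0 n0 xc.
have [m [y [yv ym]] mmin] : exists2 m, (exists y, valid V x y /\ #|argmaxs x y| = m) &
    forall y, valid V x y -> (m <= #|argmaxs x y|)%N.
  have ex : exists m, `[< exists y, valid V x y /\ #|argmaxs x y| = m >].
    by exists #|argmaxs x y0|; apply/asboolP; exists y0.
  exists (ex_minn ex); case: ex_minnP => m /asboolP // h hm z zv.
  by apply: hm; apply/asboolP; exists z.
have [yc yS] := yv; pose S := argmaxs x y.
have S0 : S != set0 := argmaxs_neq0 x y (Ordinal n0).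
have [A [i [r [[Af iA iS AS] [iAf rS riA hA]]]]] := exists_entering acc yc S0 yS.
have [e [e0 _ yc' te]] := feasible_raise yc Af (ltr01 : 0 < 1 :> R).
set y' := raise y e A in yc' te.
have ne s : top V y s != set0.
  by have [j js] := top_exists V y s i; apply/set0Pn; exists j.
have Sy' : argmaxs x y' = S.
  rewrite argmaxs_raise//; last first.
    apply: contra S0 => SA; rewrite -setI_eq0 in AS.
    by rewrite -subset0 -(eqP AS) subsetI SA subxx.
  by apply/setDidPl; rewrite disjoint_sym.
have noS s : ~~ (top V y' s \subset S).
  rewrite te; case: ifPn => // sA; apply: contra sA => sA.
  by apply: hA; rewrite -subDset.
pose C : {set 'I_n} := \bigcup_(s | top V y' s \subset i |: S) top V y' s.
have Cf : feasible V y' C.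
  move=> j /bigcupP[s sS js]; exists s; split => //.
  exact: (bigcup_sup s).
have [s0 [is0 s0A]] : exists s, i \in top V y s /\ top V y s \subset i |: A.
  by apply: iAf; rewrite setU11.
have ti : top V y' s0 = [set i]%SET.
  rewrite te; case: ifPn => [/subsetP/(_ i is0)|_]; first by rewrite (negbTE iA).
  apply/eqP; rewrite eqEsubset sub1set in_setD iA is0 /= andbT.
  by rewrite subDset setUC.
have rC : top V y' r \subset C.
  apply: bigcup_sup; rewrite te; case: ifPn => rA.
    case/negP: rS; exact: disjointWl rA AS.
  by rewrite subDset setUCA setUA.
have CS : ~~ [disjoint C & S].
  move: rS; rewrite -!setI_eq0 => /set0Pn[j]; rewrite inE => /andP[jr jS].
  apply/set0Pn; exists j; rewrite inE jS andbT.
  apply: (subsetP rC); rewrite te; case: ifPn => // _.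
  rewrite in_setD jr andbT; apply/negP => jA.
  by move/pred0P: AS => /(_ j); rewrite /= jA jS.
have [SC|SC] := boolP (S \subset C).
  exists y', i; rewrite Sy'; split => //; first by exists s0.
  move=> k kS; have /bigcupP[s sS ks] := subsetP SC k kS.
  by exists s.
(* Raising on [C] preserves validity and leaves the maximizers [S :\: C], which are fewer because
   [C] meets [S]. *)
have [e' [e'0 _ yc'' te']] := feasible_raise yc' Cf (ltr01 : 0 < 1 :> R).
have Sy'' : argmaxs x (raise y' e' C) = S :\: C by rewrite argmaxs_raise ?Sy'.
have /mmin : valid V x (raise y' e' C).
  split=> // s; rewrite Sy'' te'; case: ifPn => [sC|sC].
    apply: contra (noS s) => sSC; exact: subset_trans sSC (subsetDl _ _).
  apply: contra sC => sC; apply: bigcup_sup.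
  have sSC : top V y' s \subset S :|: C.
    rewrite setUC -subDset; exact: subset_trans sC (subsetDl _ _).
  apply: subset_trans sSC _; rewrite subUset subsetUr /=.
  by apply/bigcupsP.
rewrite Sy'' -ym leqNgt; case/negP; apply: proper_card.
by rewrite -/S properE subsetDl; apply: contra CS => SSC;
   rewrite disjoint_sym; move: SSC; rewrite subsetD => /andP[].
Qed.

End Tops.

(** * Separation by leading coefficients *)

Section Residue.
Context (R : realFieldType) (n p : nat) (A : 'I_p -> 'I_n -> R).
Context (T : 'I_p -> {set 'I_n}) (S : {set 'I_n}) (i : 'I_n).
Context (A_gt0 : forall r j, j \in T r -> 0 < A r j).
Context (A_eq0 : forall r j, j \notin T r -> A r j = 0).
Context (S_neq0 : S != set0).
Context (TS : forall r, ~~ (T r \subset S)).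
Context (Ti : exists r, T r = [set i]).
Context (covS : forall k, k \in S -> exists r, k \in T r /\ T r \subset i |: S).
(** This size makes [(m - 1) / N], the total of [m - 1] small entries of a row, less than the slack
    [(4 * m)^-1]. *)
Let N : R := (4 * n ^ 2)%:R.
Context (dominated : forall r k l, T r \subset i |: S ->
  k \in S -> l \in S -> k \in T r -> l \in T r -> k != l ->
  exists t q, [/\ (t == k) || (t == l), T q \subset i |: S &
    N * A r t * A q i <= A q t * A r i]).
Context (spanA : forall f : 'I_n -> R,
  (forall r, \sum_j f j * A r j = 0) -> forall j, f j = 0).

Let m : R := #|S|%:R.

Let A_ge0 r j : 0 <= A r j.
Proof. by have [/A_gt0/ltW//|/A_eq0->] := boolP (j \in T r). Qed.

Let iS : i \notin S.
Proof.
have [r ri] := Ti; have := TS r; rewrite ri; apply: contra => iS.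
by rewrite sub1set.
Qed.

Let iT r : T r \subset i |: S -> i \in T r.
Proof. by move/mem_subU1; exact. Qed.

Let m_ge1 : 1 <= m.
Proof. by rewrite /m ler1n card_gt0. Qed.

Let Nm : 4 * m ^+ 2 <= N.
Proof.
rewrite /N /m natrM natrX ler_pM2l// lerXn2r ?nnegrE// ler_nat.
by rewrite -[X in (_ <= X)%N]card_ord max_card.
Qed.

Let N_ge4 : 4 <= N.
Proof. by apply: le_trans Nm; have := m_ge1; nra. Qed.

Let sum_split (F : 'I_n -> R) :
  \sum_j F j = F i + \sum_(k in S) F k + \sum_(j | j \notin i |: S) F j.
Proof.
rewrite (bigD1 i)//= (bigID (mem S))/= addrA; congr (_ + _ + _).
  apply: eq_bigl => j; have [jS|] := boolP (j \in S); rewrite ?andbF// andbT.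
  by apply: contraNneq iS => <-.
by apply: eq_bigl => j; rewrite in_setU1 negb_or.
Qed.

(** The largest ratio is positive by [covS], so the generator attaining it touches [k]. These ratios
    are the scaling factors. *)
Let best : exists q : 'I_n -> 'I_p, forall k, k \in S ->
  [/\ T (q k) \subset i |: S, k \in T (q k) &
  forall r, T r \subset i |: S -> A r k / A r i <= A (q k) k / A (q k) i].
Proof.
suff /choice[q qP] : forall k, exists q, k \in S -> [/\ T q \subset i |: S,
    k \in T q & forall r, T r \subset i |: S -> A r k / A r i <= A q k / A q i].
  by exists q.
move=> k.
have [kS|kS] := boolP (k \in S); last by have [r _] := Ti; exists r.
have [r0 [kr0 r0S]] := covS kS.
have [q qS qm] := exists_argmax (P := fun r => T r \subset i |: S)
  (fun r => A r k / A r i) r0S.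
exists q => _; split => //; apply/negPn/negP => kq.
have := qm r0 r0S; rewrite (A_eq0 kq) mul0r.
by rewrite leNgt divr_gt0 ?A_gt0 ?iT.
Qed.

(* The scaled rows [b r] of the vectors supported in [i |: S] are, up to an error
   at most 1/N, bounded by unit vectors, so that the polar of these rows is close
   to a cube with upper corner (1,...,1). *)
Lemma residue_separation : exists f0 q : 'I_n -> R,
  [/\ forall r, 0 < \sum_j f0 j * A r j, \sum_j f0 j * q j < 0 &
   forall f, (exists j, f j != 0) -> (forall r, 0 <= \sum_j f j * A r j) ->
     \sum_j f j * q j <= 0 -> forall k, k \in S -> f k < 0].
Proof.
have [q qP] := best.
pose rho k := A (q k) k / A (q k) i.
have rho_gt0 k : k \in S -> 0 < rho k.
  by move=> /qP[qS kq _]; rewrite divr_gt0 ?A_gt0 ?iT.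
pose b r k := A r k / A r i / rho k.
have Ai r : T r \subset i |: S -> 0 < A r i by move=> /iT/A_gt0.
have b_ge0 r k : k \in S -> 0 <= b r k.
  by move=> kS; rewrite !divr_ge0// ltW// rho_gt0.
have b_le1 r k : T r \subset i |: S -> k \in S -> b r k <= 1.
  move=> rS kS; rewrite ler_pdivrMr ?rho_gt0// mul1r.
  by have [_ _] := qP k kS; apply.
(* For the coordinate [t] given by [dominated], the ratio is at most 1/N times that of another
   generator, hence of the best one. *)
have bN r k l : T r \subset i |: S -> k \in S -> l \in S -> k != l ->
    b r k <= N^-1 \/ b r l <= N^-1.
  move=> rS kS lS kl; have N0 : 0 <= N^-1 by rewrite invr_ge0; have := N_ge4; lra.
  have [kr|kr] := boolP (k \in T r); last by left; rewrite /b A_eq0// !mul0r.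
  have [lr|lr] := boolP (l \in T r); last by right; rewrite /b A_eq0// !mul0r.
  have [t [s [tkl sS ts]]] := dominated rS kS lS kr lr kl.
  have tS : t \in S by case/orP: tkl => /eqP->.
  suff : b r t <= N^-1 by case/orP: tkl => /eqP->; [left|right].
  rewrite ler_pdivrMr ?rho_gt0// ler_pdivlMl; last by have := N_ge4; lra.
  have [_ _ /(_ s sS)] := qP t tS; apply: le_trans.
  rewrite ler_pdivlMr ?Ai//.
  have -> : N * (A r t / A r i) * A s i = N * A r t * A s i / A r i by ring.
  by rewrite ler_pdivrMr ?Ai.
pose eps := (m - 1) / N; pose dl := (4 * m)^-1.
have N_gt0 : 0 < N by have := N_ge4; lra.
have eps_lt : eps < dl.
  rewrite /eps /dl ltr_pdivrMr// ltr_pdivlMl; last by have := m_ge1; lra.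
  by have := Nm; have := m_ge1; nra.
have eps_ge0 : 0 <= eps by rewrite divr_ge0; have := m_ge1; have := N_ge4; try lra.
have cardD k : k \in S -> (#|S :\ k|%:R = m - 1 :> R).
  by move=> kS; rewrite /m (cardsD1 k S) kS natrD addrAC subrr add0r.
have bsum r : T r \subset i |: S -> \sum_(k in S) b r k <= 1 + eps.
  move=> rS; have [/existsP[k /andP[kS bk]]|/existsPn h] :=
    boolP [exists k, (k \in S) && (N^-1 < b r k)].
    rewrite (big_setD1 k)//= lerD ?b_le1// /eps -(cardD k kS) mulr_natl -sumr_const.
    apply: ler_sum => l; rewrite !inE => /andP[lk lS].
    by case: (bN r l k rS lS kS lk) => //; rewrite (leNgt (b r k)) bk.
  apply: (@le_trans _ _ (\sum_(k in S) N^-1)).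
    by apply: ler_sum => k kS; have := h k; rewrite kS /= -leNgt.
  rewrite sumr_const -mulr_natl -/m /eps.
  have : N^-1 <= 1 by rewrite invf_le1//; have := N_ge4; lra.
  by lra.
pose ga := 1 - dl.
have dl_gt0 : 0 < dl by rewrite invr_gt0; have := m_ge1; lra.
have mdl : m * dl = 1/4 by rewrite /dl; field; have := m_ge1; lra.
have dl_le : dl <= 1 / 4 by rewrite /dl invf_ple ?posrE; have := m_ge1; lra.
(* A weight so large that one touched coordinate outside [i |: S] outweighs the negative
   contribution of [S]. *)
pose M := \sum_(t : 'I_p * 'I_n | t.2 \in T t.1)
   (1 + \sum_(k in S) A t.1 k / rho k) / A t.1 t.2.
have rat_ge0 r : 0 <= \sum_(k in S) A r k / rho k.
  by apply: sumr_ge0 => k kS; rewrite divr_ge0// ltW// rho_gt0.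
have Mterm_ge0 t : 0 <= (1 + \sum_(k in S) A t.1 k / rho k) / A t.1 t.2.
  by rewrite divr_ge0// addr_ge0.
have M_ge0 : 0 <= M by apply: sumr_ge0.
have MP r j : j \in T r -> 1 + \sum_(k in S) A r k / rho k <= M * A r j.
  move=> jr; rewrite -ler_pdivrMr ?A_gt0// /M (bigD1 (r, j))//= lerDl.
  by apply: sumr_ge0.
(* In the scaled coordinates this is the corner (1,...,1) of the cube pulled in by the factor
   [1 - dl], which compensates row sums up to [1 + eps]. *)
pose f0 j := if j == i then 1 else if j \in S then - ga / rho j else M.
have f0A r : \sum_j f0 j * A r j =
    A r i - ga * (\sum_(k in S) A r k / rho k) + \sum_(j | j \notin i |: S) M * A r j.
  rewrite sum_split {1}/f0 eqxx mul1r mulr_sumr -sumrN; congr (_ + _ + _).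
    apply: eq_bigr => k kS; rewrite /f0 kS ifN; last by apply: contraNneq iS => <-.
    by ring.
  by apply: eq_bigr => j; rewrite in_setU1 negb_or /f0 => /andP[/negbTE-> /negbTE->].
have f0_gt0 r : 0 < \sum_j f0 j * A r j.
  rewrite f0A; have [rS|/subsetPn[j jr jS]] := boolP (T r \subset i |: S).
    rewrite [X in _ + X]big1 ?addr0 => [|j jS]; last first.
      by rewrite A_eq0 ?mulr0//; apply: contra jS => /(subsetP rS).
    have -> : \sum_(k in S) A r k / rho k = A r i * \sum_(k in S) b r k.
      rewrite mulr_sumr; apply: eq_bigr => k kS.
      by rewrite /b mulrA [_ * (_ / _)]mulrC divfK// gt_eqF ?Ai.
    have := bsum r rS; have := Ai r rS; move: (\sum_(k in S) _) => s Ari sle.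
    rewrite mulrCA -[X in X - _]mulr1 -mulrBr mulr_gt0// subr_gt0.
    apply: (@le_lt_trans _ _ (ga * (1 + eps))); first by rewrite ler_wpM2l// /ga; lra.
    by rewrite /ga; nra.
  rewrite [X in _ + X](bigD1 j)//=; have := MP r j jr.
  have : 0 <= \sum_(k < n | (k \notin i |: S) && (k != j)) M * A r k.
    by apply: sumr_ge0 => k _; rewrite mulr_ge0.
  have := A_ge0 r i; have := rat_ge0 r.
  have gs : ga * (\sum_(k in S) A r k / rho k) <= \sum_(k in S) A r k / rho k.
    by rewrite ler_piMl// /ga; lra.
  by lra.
pose z j := \sum_r A r j.
have dotz f : \sum_j f j * z j = \sum_r \sum_j f j * A r j.
  by rewrite exchange_big; apply: eq_bigr => j _; rewrite mulr_sumr.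
pose Z := \sum_j f0 j * z j.
have [r0 r0i] := Ti.
have Z_gt0 : 0 < Z.
  rewrite /Z dotz (bigD1 r0)//= ltr_wpDr//.
  by apply: sumr_ge0 => r _; exact: ltW.
pose c := (8 * Z)^-1.
have c_gt0 : 0 < c by rewrite invr_gt0; lra.
(* This cuts the corner off the cube: up to sign, the scaled coordinates must sum to [m - 1 / 2]
   times the value at [i], while [f0] reaches [m - 1 / 4]. Adding [c * z], with [z] the sum of the
   generators, makes the cut strict and costs [f0] only 1/8. *)
pose q0 j := (if j == i then m - 1 / 2 else if j \in S then rho j else 0) + c * z j.
have dotq f : \sum_j f j * q0 j =
    (m - 1 / 2) * f i + \sum_(k in S) rho k * f k + c * \sum_j f j * z j.
  rewrite /q0; have [z' ->] : exists z', z = z' by exists z.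
  rewrite sum_split [in RHS]sum_split eqxx !mulrDr !mulr_sumr.
  rewrite [X in _ + X = _](eq_bigr (fun j => c * (f j * z' j))); last first.
    move=> j; rewrite in_setU1 negb_or => /andP[/negbTE-> /negbTE->].
    by rewrite add0r mulrCA.
  rewrite [X in _ + X + _ = _](eq_bigr (fun k => rho k * f k + c * (f k * z' k))).
    by rewrite big_split/=; ring.
  move=> k kS; rewrite kS ifN; last by apply: contraNneq iS => <-.
  by ring.
exists f0, q0; split => //.
  rewrite dotq /f0 eqxx mulr1 (eq_bigr (fun=> - ga)) => [|k kS]; last first.
    rewrite kS ifN; last by apply: contraNneq iS => <-.
    by rewrite mulrC divfK// gt_eqF// rho_gt0.
  rewrite sumr_const -mulr_natr -/m -/f0 -/Z.
  have -> : c * Z = 1 / 8 by rewrite /c; field; lra.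
  by rewrite /ga; lra.
move=> f f_neq0 fA fq.
have fz : 0 < \sum_j f j * z j.
  rewrite lt_neqAle dotz sumr_ge0// andbT eq_sym; apply/eqP => /eqP.
  rewrite psumr_eq0// => /allP f0'; have [j /eqP[]] := f_neq0.
  by apply: spanA => r; apply/eqP; apply: f0'; rewrite mem_index_enum.
have phi_ge0 : 0 <= f i.
  have := fA r0; rewrite (bigD1 i)//= [X in _ + X]big1 => [|j ji].
    by rewrite addr0 pmulr_lge0// A_gt0 // r0i set11.
  by rewrite A_eq0 ?mulr0// r0i inE.
pose g k := - (rho k * f k).
have gsum : (m - 1 / 2) * f i < \sum_(k in S) g k.
  move: fq; rewrite dotq /g sumrN; have : 0 < c * \sum_j f j * z j by exact: mulr_gt0.
  by move: (\sum_(k in S) _) (c * _) => ? ?; lra.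
have row r : T r \subset i |: S -> \sum_(k in S) b r k * g k <= f i.
  move=> rS; have := fA r; rewrite sum_split [X in _ + X]big1 => [|j jS]; last first.
    by rewrite A_eq0 ?mulr0//; apply: contra jS => /(subsetP rS).
  rewrite addr0 [X in _ + X](eq_bigr (fun k => A r i * - (b r k * g k))) => [|k kS].
    rewrite -mulr_sumr mulrC -mulrDr pmulr_rge0 ?Ai// sumrN.
    by rewrite subr_ge0.
  rewrite /b /g; have := Ai r rS; have := rho_gt0 k kS => h1 h2; field.
  by rewrite !gt_eqF.
pose neg k := Num.max 0 (- g k).
have neg_ge0 k : 0 <= neg k by rewrite le_max lexx.
have negg k : - g k <= neg k by rewrite le_max lexx orbT.
pose G := \sum_(k in S) neg k.
have G_ge0 : 0 <= G by exact: sumr_ge0.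
(* In the row [q k] all entries on [S] other than the one at [k] are at most 1/N, so they contribute
   at least [- (G / N)]. *)
have gle k : k \in S -> g k <= f i + G / N.
  move=> kS; have [qS kq _] := qP k kS.
  have bk : b (q k) k = 1.
    by rewrite /b divff// gt_eqF// rho_gt0.
  have := row _ qS; rewrite (big_setD1 k)//= bk mul1r.
  have : - (G / N) <= \sum_(l in S :\ k) b (q k) l * g l.
    rewrite /G (big_setD1 k)//= mulrDl opprD.
    have : 0 <= neg k / N by rewrite divr_ge0// ltW.
    suff : - (\sum_(l in S :\ k) neg l / N) <= \sum_(l in S :\ k) b (q k) l * g l.
      by rewrite -mulr_suml; lra.
    rewrite -sumrN; apply: ler_sum => l; rewrite !inE => /andP[lk lS].
    have bl : b (q k) l <= N^-1.
      case: (bN (q k) l k qS lS kS lk) => //; rewrite bk leNgt invf_lt1//.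
      by have := N_ge4; case: ltP => //; lra.
    have := negg l; have := neg_ge0 l; have := b_ge0 (q k) l lS.
    by nra.
  by lra.
(* If [g k <= 0], only [m - 1] positive parts remain, each at most [f i + G / N]. As
   [(m - 1) * (G / N) <= G], the sum of [g] is at most [(m - 1) * f i], contradicting [gsum]. *)
move=> k kS; rewrite ltNge; apply/negP => fk.
have gk : g k <= 0 by rewrite oppr_le0 mulr_ge0// ltW// rho_gt0.
have GN : 0 <= G / N by rewrite divr_ge0// ltW.
have : \sum_(l in S) (g l + neg l) <= (m - 1) * (f i + G / N).
  rewrite (big_setD1 k)//= -(cardD k kS) mulr_natl -sumr_const -[leRHS]add0r lerD//.
    by rewrite /neg; case: (leP 0 (- g k)); lra.
  apply: ler_sum => l; rewrite !inE => /andP[_ lS]; have := gle l lS.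
  by rewrite /neg; case: (leP 0 (- g l)); lra.
rewrite big_split/= -/G.
have : (m - 1) * (G / N) <= G.
  have -> : (m - 1) * (G / N) = eps * G by rewrite /eps; ring.
  by rewrite ler_piMl//; lra.
by rewrite mulrDr; lra.
Qed.
End Residue.

(** * Facets of a cone over an ordered field *)

Section FacetNormal.
Context (F : realFieldType) (n p : nat) (w : 'I_p -> 'rV[F]_n).

Definition dotr (f x : 'rV[F]_n) : F := \sum_i f 0 i * x 0 i.

Lemma dotrDl f g x : dotr (f + g) x = dotr f x + dotr g x.
Proof. by rewrite -big_split; apply: eq_bigr => i _; rewrite mxE mulrDl. Qed.

Lemma dotrZl a f x : dotr (a *: f) x = a * dotr f x.
Proof. by rewrite mulr_sumr; apply: eq_bigr => i _; rewrite mxE mulrA. Qed.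

Lemma dotr_sumr f (I : finType) (g : I -> 'rV_n) :
  dotr f (\sum_k g k) = \sum_k dotr f (g k).
Proof.
rewrite exchange_big; apply: eq_bigr => i _.
by rewrite summxE mulr_sumr.
Qed.

Lemma dotrZr a f x : dotr f (a *: x) = a * dotr f x.
Proof. by rewrite mulr_sumr; apply: eq_bigr => i _; rewrite mxE mulrCA. Qed.

(** Rows that are not tight are zeroed instead of deleted, so that all these matrices have the same
    format and their row spaces can be compared. *)
Definition tight_mx f : 'M[F]_(p, n) :=
  \matrix_(r, j) (if dotr f (w r) == 0 then w r 0 j else 0).

Lemma mul_tight_mx h f r : (h *m (tight_mx f)^T) 0 r =
  if dotr f (w r) == 0 then dotr h (w r) else 0.
Proof.
rewrite mxE; case: ifP => fr.
  by apply: eq_bigr => j _; rewrite !mxE fr.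
by rewrite big1// => j _; rewrite !mxE fr mulr0.
Qed.

Context (span : forall h, (forall r, dotr h (w r) = 0) -> h = 0).

(* Among the vectors orthogonal to the generators tight for [f], some [h] is
   orthogonal to the sum of all the generators and not a multiple of [f]; moving
   along [h] until a new generator becomes tight increases the rank. *)
Lemma exists_facet_normal f q : (forall r, 0 <= dotr f (w r)) -> dotr f q < 0 ->
  exists f', [/\ forall r, 0 <= dotr f' (w r), dotr f' q < 0 &
    (n.-1 <= \rank (tight_mx f'))%N].
Proof.
move: {2}(n - _)%N (leqnn (n - \rank (tight_mx f))) => m.
elim: m f => [|m IH] f rk fw fq.
  by exists f; split => //; move: rk; lia.
have rank_step b : (\rank (tight_mx f) < b)%N -> (b <= n)%N -> (n - b <= m)%N by lia.
have [rf|rf] := leqP n.-1 (\rank (tight_mx f)); first by exists f.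
have : ~~ (kermx (tight_mx f)^T <= f)%MS.
  apply/negP => /mxrankS; rewrite mxrank_ker mxrank_tr.
  by have := rank_leq_row f; lia.
case/row_subPn => i; set h0 := row i _ => h0f.
have h0t r : dotr f (w r) = 0 -> dotr h0 (w r) = 0.
  move=> fr; have : h0 *m (tight_mx f)^T = 0 by rewrite -row_mul mulmx_ker row0.
  by move=> /matrixP/(_ 0 r); rewrite mul_tight_mx fr eqxx mxE.
pose z := \sum_r w r.
have f_neq0 : f != 0.
  apply/eqP => f0; move: fq; rewrite f0 /dotr big1 ?ltxx// => j _.
  by rewrite mxE mul0r.
have fz : 0 < dotr f z.
  rewrite lt_neqAle dotr_sumr sumr_ge0// andbT eq_sym psumr_eq0//.
  apply/negP => /allP f0; case/eqP: f_neq0; apply: span => r; apply/eqP.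
  by apply: f0; rewrite mem_index_enum.
pose h1 := h0 + (- (dotr h0 z / dotr f z)) *: f.
have h1_neq0 : h1 != 0.
  apply: contraNneq h0f => /eqP; rewrite addr_eq0 -scaleNr opprK => /eqP->.
  exact: scalemx_sub.
have h1z : dotr h1 z = 0 by rewrite dotrDl dotrZl mulNr divfK ?subrr// gt_eqF.
have h1t r : dotr f (w r) = 0 -> dotr h1 (w r) = 0.
  by move=> fr; rewrite dotrDl dotrZl fr mulr0 addr0 h0t.
(* Of the two signs of [h1], the one that does not increase the value at [q] is taken. *)
have [h [h_neq0 hz ht hq]] : exists h, [/\ h != 0, dotr h z = 0,
    forall r, dotr f (w r) = 0 -> dotr h (w r) = 0 & dotr h q <= 0].
  have [h1q|/ltW h1q] := leP (dotr h1 q) 0; first by exists h1.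
  exists (-1 *: h1); split; rewrite ?dotrZl ?h1z ?mulr0//.
  - by rewrite scaler_eq0 oppr_eq0 oner_eq0.
  - by move=> r fr; rewrite dotrZl h1t// mulr0.
  - by rewrite mulN1r oppr_le0.
have [r0 hr0] : exists r, dotr h (w r) < 0.
  apply: contrapT => /forallNP hr.
  have hr_ge0 r : 0 <= dotr h (w r) by rewrite leNgt; apply/negP.
  case/eqP: h_neq0; apply: span => r; apply/eqP.
  move/eqP: hz; rewrite dotr_sumr psumr_eq0// => /allP; apply.
  by rewrite mem_index_enum.
(* A ratio test: [r] is the first constraint to become tight along [h], found as the maximum of the
   negated ratios. *)
have [r hr rmax] := exists_argmax (P := fun r => dotr h (w r) < 0)
  (fun r => - (dotr f (w r) / - dotr h (w r))) hr0.
pose s := dotr f (w r) / - dotr h (w r).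
have s_gt0 : 0 < s.
  rewrite divr_gt0 ?oppr_gt0// lt_neqAle fw andbT eq_sym.
  by apply/eqP => /ht hr'; move: hr; rewrite hr' ltxx.
have f1r : dotr (f + s *: h) (w r) = 0.
  by rewrite dotrDl dotrZl /s; field; lra.
have tsub : (tight_mx f <= tight_mx (f + s *: h))%MS.
  apply/row_subP => t; have [ft|ft] := eqVneq (dotr f (w t)) 0; last first.
    suff -> : row t (tight_mx f) = 0 by exact: sub0mx.
    by apply/rowP => j; rewrite !mxE (negbTE ft).
  suff -> : row t (tight_mx f) = row t (tight_mx (f + s *: h)) by exact: row_sub.
  by apply/rowP => j; rewrite !mxE dotrDl dotrZl ft ht// mulr0 addr0 eqxx.
(* The vector [h] is orthogonal to the old tight rows but not to the new one, so the rank grows. *)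
have tlt : (tight_mx f < tight_mx (f + s *: h))%MS.
  rewrite ltmxE tsub /=; apply/negP => /submxP[D Df].
  have hk : h *m (tight_mx f)^T = 0.
    by apply/rowP => t; rewrite mul_tight_mx mxE; case: ifP => // /eqP/ht.
  have := mul_tight_mx h (f + s *: h) r; rewrite f1r eqxx Df trmx_mul mulmxA hk.
  by rewrite mul0mx mxE => hr'; move: hr; rewrite -hr' ltxx.
apply: (IH (f + s *: h)).
- exact: rank_step (rank_ltmx tlt) (rank_leq_col _).
- move=> t; rewrite dotrDl dotrZl; have [ht0|ht0] := leP 0 (dotr h (w t)).
    by rewrite addr_ge0// mulr_ge0// ltW.
  have := rmax t ht0; rewrite lerN2 -/s ler_pdivlMr ?oppr_gt0//.
  by rewrite mulrN; lra.
- rewrite dotrDl dotrZl; have : s * dotr h q <= 0 by rewrite pmulr_rle0.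
  by lra.
Qed.

Definition tight f := [set r | dotr f (w r) == 0].

Lemma dotr_span f (X : seq 'rV[F]_n) : {in X, forall x, dotr f x = 0} ->
  forall u, u \in <<X>>%VS -> dotr f u = 0.
Proof.
move=> fX u /(@coord_span _ _ _ (in_tuple X)) ->; rewrite dotr_sumr big1// => i _.
by rewrite dotrZr fX ?mulr0// mem_nth.
Qed.

(** A maximal free family of rows contains no zero row, hence consists of tight generators.
    Conversely, if the tight generators spanned everything, [f] would vanish on all generators and
    be 0. *)
Lemma dim_span_tight f : f != 0 -> (n.-1 <= \rank (tight_mx f))%N ->
  \dim <<[seq w r | r in tight f]>> = n.-1.
Proof.
move=> f_neq0 rf; apply/eqP; rewrite eqn_leq; apply/andP; split; last first.
  pose g := maxrankfun (tight_mx f); pose B := rowsub g (tight_mx f).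
  have gt a : g a \in tight f.
    rewrite inE; apply: contraT => fa.
    have : row a B = 0 by apply/rowP => j; rewrite !mxE (negbTE fa).
    rewrite rowE -[RHS](mul0mx _ B) => /(row_free_inj (maxrowsub_free _)).
    by move=> /rowP/(_ a)/eqP; rewrite !mxE !eqxx oner_eq0.
  have freeX : free [tuple w (g a) | a < \rank (tight_mx f)].
    apply/freeP => k; rewrite (eq_bigr (fun a => k a *: row a B)) => [sk a|a _].
      have : (\row_a k a) *m B = 0.
        by rewrite mulmx_sum_row -[RHS]sk; apply: eq_bigr => b _; rewrite mxE.
      rewrite -[RHS](mul0mx _ B) => /(row_free_inj (maxrowsub_free _)).
      by move=> /rowP/(_ a); rewrite !mxE.
    rewrite nth_mktuple; congr (_ *: _); apply/rowP => j; rewrite !mxE.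
    by have := gt a; rewrite inE => ->.
  apply: leq_trans rf _; have := freeX; rewrite /free size_tuple => /eqP <-.
  apply: dimvS; apply/span_subvP => u /mapP[a _ ->]; apply: memv_span.
  by apply/imageP; exists (g a).
have le_n : (\dim <<[seq w r | r in tight f]>> <= n)%N.
  by have := dimvS (subvf <<[seq w r | r in tight f]>>); rewrite dimvf dim_matrix mul1r.
suff : \dim <<[seq w r | r in tight f]>> != n by lia.
apply: contraNneq f_neq0 => dn; apply/eqP; apply: span => r.
apply: (@dotr_span _ [seq w r | r in tight f]).
  by move=> x /imageP[t]; rewrite inE => /eqP ft ->.
suff -> : <<[seq w r | r in tight f]>>%VS = fullv by exact: memvf.
by apply/eqP; rewrite -(dimv_leqif_eq (subvf _)) dn dimvf dim_matrix mul1r.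
Qed.

End FacetNormal.

(** * Purity *)

Section PureAccessible.
Context (R : realType) (n p : nat) (v : 'I_p -> TP R n) (V : 'I_p -> 'I_n -> R).
Context (Vv : forall r, tp_pi (\row_i V r i) = v r) (n_gt0 : (0 < n)%N).

(** The best coefficient of [r] is minus the maximum of [V r - x], and it attains [x] exactly at the
    touched coordinates. The constants [c] account for the choice of representatives. *)
Lemma tropical_polytopeP (x : 'rV[R]_n) :
  tropical_polytope v (tp_pi x) <-> covered V (x 0).
Proof.
have /choice[c cP] : forall r, exists c, forall i, tp_repr (v r) 0 i = V r i + c.
  move=> r; have : tp_pi (tp_repr (v r)) = tp_pi (\row_i V r i).
    by rewrite Vv tp_reprK.
  by move=> /tp_piP[c cP]; exists c => i; rewrite cP mxE.
split.
  move=> [x' [la x'la]] /tp_piP[d dP] i.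
  have x'ge r j : la r + tp_repr (v r) 0 j <= x' 0 j.
    by rewrite -lee_fin x'la; exact: le_bigmax.
  have [r x'r] : exists r, x' 0 i = la r + tp_repr (v r) 0 i.
    apply: contrapT => /forallNP h; have := lexx (x' 0 i)%:E.
    rewrite {2}x'la leNgt => /negP; apply; apply/bigmax_ltP; split.
      exact: ltNyr.
    move=> r _; rewrite lte_fin lt_neqAle x'ge andbT.
    by apply/eqP => /esym; exact: h.
  exists r; apply/topP => j.
  by have := x'ge r j; move: x'r; rewrite !cP !dP; lra.
move=> xc; pose i0 := Ordinal n_gt0.
have /choice[mu muP] : forall r, exists mu, (forall j, V r j - x 0 j <= mu) /\
    forall j, j \in top V (x 0) r -> V r j - x 0 j = mu.
  move=> r; have [i ir] := top_exists V (x 0) r i0.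
  exists (V r i - x 0 i); split; first exact/topP.
  by move=> j jr; exact: top_eq jr ir.
exists x => //; exists (fun r => - mu r - c r) => i; apply/eqP; rewrite eq_le; apply/andP; split.
  have [r ir] := xc i; apply: le_trans (le_bigmax _ _ r).
  by rewrite lee_fin cP; have := (muP r).2 i ir; lra.
apply: bigmax_le; first exact: leNye.
by move=> r _; rewrite lee_fin cP; have := (muP r).1 i; lra.
Qed.

Lemma tp_pi_open_box (z : 'rV[R]_n) (e : R) : open
  [set P : TP R n | exists u, P = tp_pi u /\ forall i, `|u 0 i - z 0 i| < e]%classic.
Proof.
rewrite /open/= /quotient_open openE => u [u' [/tp_piP[c uc] hu]].
have [|d d0 hd] := @finite_pos_lb R 'I_n xpredT (fun i => e - `|u' 0 i - z 0 i|).
  by move=> i _; rewrite subr_gt0.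
apply/nbhs_ballP; exists d => //= t [_ ut].
exists (\row_i (t 0 i - c)); split.
  by apply/tp_piP; exists c => i; rewrite mxE subrK.
move=> i; rewrite mxE.
have := ut 0 i; rewrite /ball/= uc => h.
have -> : t 0 i - c - z 0 i = (u' 0 i - z 0 i) - (u' 0 i + c - t 0 i) by lra.
apply: le_lt_trans (ler_normB _ _) _.
by have := hd i isT; lra.
Qed.

(** Purity provides an interior point in any box around [z], and an interior point leaves room for
    lowering one coordinate. *)
Lemma pure_near (z : 'rV[R]_n) (e : R) : pure (tropical_polytope v) ->
  covered V (z 0) -> 0 < e -> exists u : 'I_n -> R,
    (forall i, `|u i - z 0 i| < e) /\
    forall b, exists t, [/\ 0 < t, t < e & covered V (fun j => u j - (if j == b then t else 0))].
Proof.
move=> pv zc e0; have : tropical_polytope v (tp_pi z) by apply/tropical_polytopeP.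
rewrite [X in X _]pv => clz; have := @tp_pi_open_box z e; set U := (X in open X) => oU.
have Uz : U (tp_pi z) by exists z; split => // i; rewrite subrr normr0.
have [P [Pint [u [Pu hu]]]] := clz _ (open_nbhs_nbhs (conj oU Uz)).
exists (u 0); split => // b.
have : nbhs u (@tp_pi R n @^-1` tropical_polytope v)%classic.
  by apply: (@pi_continuous _ {eq_quot @tp_equiv R n}%qT u); rewrite -[X in nbhs X _]/(tp_pi u) -Pu.
move=> /nbhs_ballP[d /= d0 hd]; pose t := Num.min d e / 2.
have m0 : 0 < Num.min d e by rewrite lt_min d0.
have t0 : 0 < t by rewrite divr_gt0.
have : t < Num.min d e by rewrite /t; lra.
rewrite lt_min => /andP[td te]; exists t; split => //.
have : tropical_polytope v (tp_pi (\row_j (u 0 j - (if j == b then t else 0)))).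
  apply: hd; split => // k j; rewrite /ball/= mxE ord1 opprB addrC subrK.
  by case: ifP; rewrite ?normr0// gtr0_norm.
move=> /tropical_polytopeP h i; have [r ir] := h i; exists r; move: ir.
rewrite (@eq_top _ _ _ V _ (fun j => u 0 j - (if j == b then t else 0)))// => j.
by rewrite mxE.
Qed.

(* Near [x + e 1_B] there is an interior point [u] of the polytope. Lowering [u] a
   little at the coordinate [b] of [B] where [u - x] is least makes this minimum
   unique, so [B :\ b] becomes a superlevel set of the perturbation. *)
Lemma pure_accessible : pure (tropical_polytope v) -> accessible V.
Proof.
move=> pv x B xc Bf /set0Pn[b0 b0B].
have [g g0 hg] := top_perturb V x.
have [e [e0 eg zc _]] := feasible_raise xc Bf (divr_gt0 g0 (ltr0n R 4)).
(* With precision [e / 4], and [t] below [e / 4], the difference from [x] exceeds [e / 2] on [B] and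
   stays below [e / 4] off [B]. *)
have [|u [uz ub]] := @pure_near (\row_j raise x e B j) (e / 4) pv _ (divr_gt0 e0 (ltr0n R 4)).
  move=> i; have [r ir] := zc i; exists r.
  by rewrite (@eq_top _ _ _ V _ (raise x e B))// => j; rewrite mxE.
have [b bB bm] := exists_argmax (P := fun j => j \in B) (fun j => - (u j - x j)) b0B.
have [t [t0 te yc]] := ub b.
pose d j := u j - (if j == b then t else 0) - x j.
have uB j : `|u j - x j - (if j \in B then e else 0)| < e / 4.
  by have := uz j; rewrite mxE /raise opprD addrA.
have dB j : j \in B -> e / 2 < d j /\ d j < 2 * e.
  move=> jB; have := uB j; rewrite jB /d ltr_norml => /andP[].
  by case: ifP; lra.
have dNB j : j \notin B -> - e < d j /\ d j < e / 4.
  move=> jB; have := uB j; rewrite (negbTE jB) /d ltr_norml => /andP[].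
  by case: ifP; lra.
have dg j : `|d j| < g.
  rewrite ltr_norml; have [/dB|/dNB] := boolP (j \in B); move=> []; first by lra.
  by lra.
exists b => // i; rewrite in_setD1 => /andP[ib iB].
have [r] := yc i; rewrite (@eq_top _ _ _ V _ (fun j => x j + d j)); last first.
  by move=> j; rewrite /d; ring.
rewrite hg// => /andP[ir /forall_inP dr]; exists r; split => //.
apply/subsetP => j jr; have dij := dr j jr; rewrite in_setD1; apply/andP; split.
  apply: contraTneq dij => ->; rewrite -ltNge /d eqxx (negbTE ib).
  by have := bm i iB; lra.
by apply: contraTT dij => /dNB[_ dj]; rewrite -ltNge; have [] := dB i iB; lra.
Qed.

End PureAccessible.

(** * Lowest terms and valuations of half-spaces *)

Section LowestTerm.
Context (R : realType).
Implicit Types (x y : hahn R) (a b m : R).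

(** The coefficient at [m] may vanish, unlike in [least_exp]. It thus acts as a residue, compatible
    with sums and products and weakly monotone in sign. *)
Definition exp_lb x m := forall d, x d != 0 -> m <= d.

Lemma exp_lb0 m : exp_lb 0 m.
Proof. by move=> d; rewrite Defs.coef0 eqxx. Qed.

Lemma exp_lbW x a b : b <= a -> exp_lb x a -> exp_lb x b.
Proof. by move=> ba xa d /xa; exact: le_trans. Qed.

Lemma exp_lb_alpha x : exp_lb x (alpha_min x).
Proof.
have [->|/alpha_minP[]//] := eqVneq x 0; exact: exp_lb0.
Qed.

Lemma exp_lb_hmono k a : exp_lb (hmono k a) a.
Proof. by move=> d; rewrite /= /mono_fun; case: (eqVneq d a) => [->//|_]; rewrite eqxx. Qed.

Lemma coef_hmono k a b : hmono k a b = if b == a then k else 0 :> R.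
Proof. by []. Qed.

Lemma exp_lbN x m : exp_lb x m -> exp_lb (- x) m.
Proof. by move=> xm d; rewrite Defs.coefN oppr_eq0; exact: xm. Qed.

Lemma exp_lbM x y a b : exp_lb x a -> exp_lb y b -> exp_lb (x * y) (a + b).
Proof. by move=> xa yb d; exact: coefM_low. Qed.

Lemma coefM_lb x y a b : exp_lb x a -> exp_lb y b ->
  (x * y) (a + b) = x a * y b.
Proof.
move=> xa yb; rewrite Defs.coefM (@convE _ _ _ _ [set a]%classic).
  by rewrite fsbig_set1 addrC addKr.
move=> u xu yu; apply/eqP; rewrite eq_le xa// andbT.
by have := yb _ yu; lra.
Qed.

Lemma hahn_coef_sum (I : Type) (s : seq I) (P : pred I) (F : I -> hahn R) a :
  (\sum_(i <- s | P i) F i) a = \sum_(i <- s | P i) F i a.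
Proof. exact: (big_morph (fun x : hahn R => x a)). Qed.

Lemma exp_lb_sum (I : finType) (F : I -> hahn R) m :
  (forall i, exp_lb (F i) m) -> exp_lb (\sum_i F i) m.
Proof.
move=> Fm d; rewrite hahn_coef_sum leNgt; apply: contraNN => dm.
rewrite big1// => i _; apply/eqP; apply: contraTT dm => /Fm.
by rewrite leNgt.
Qed.

Lemma gt0_coef x m : exp_lb x m -> 0 < x m -> 0 < x.
Proof.
move=> xm x0; rewrite hahn_gt0 (@alpha_minE _ _ m)//.
by split => //; rewrite gt_eqF.
Qed.

Lemma lt0_coef x m : exp_lb x m -> x m < 0 -> x < 0.
Proof.
move=> /exp_lbN xm x0; rewrite -oppr_gt0; apply: (gt0_coef xm).
by rewrite Defs.coefN oppr_gt0.
Qed.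

Lemma coef_ge0 x m : exp_lb x m -> 0 <= x -> 0 <= x m.
Proof.
by move=> xm; apply: contraTT; rewrite -!ltNge; exact: lt0_coef.
Qed.

Lemma coef_le0 x m : exp_lb x m -> x <= 0 -> x m <= 0.
Proof. by move=> xm; apply: contraTT; rewrite -!ltNge; exact: gt0_coef. Qed.

Lemma coef_alpha_gt0 x : 0 < x -> 0 < x (alpha_min x).
Proof. by rewrite hahn_gt0. Qed.

Lemma alpha_min_hmono k a : k != 0 -> alpha_min (hmono k a) = a.
Proof.
move=> k0; apply: alpha_minE; split; last exact: exp_lb_hmono.
by rewrite coef_hmono eqxx.
Qed.

Lemma hmono_gt0 k a : 0 < k -> 0 < hmono k a.
Proof.
by move=> k0; apply: (gt0_coef (@exp_lb_hmono k a)); rewrite coef_hmono eqxx.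
Qed.

Lemma alpha_minN x : alpha_min (- x) = alpha_min x.
Proof.
have [->|/alpha_minP[h1 h2]] := eqVneq x 0; first by rewrite oppr0.
apply: alpha_minE; split; first by rewrite Defs.coefN oppr_eq0.
by apply: exp_lbN.
Qed.

Lemma fine_hval x : x != 0 -> fine (hval x) = - alpha_min x.
Proof. by move=> /negbTE x0; rewrite /hval x0. Qed.

Lemma alpha_minM x y : x != 0 -> y != 0 ->
  alpha_min (x * y) = alpha_min x + alpha_min y.
Proof.
by move=> /alpha_minP x0 /alpha_minP y0; apply: alpha_minE; exact: least_expM.
Qed.

Lemma hahn_coefMn x k a : (x *+ k) a = x a *+ k.
Proof. by elim: k => // k IH; rewrite !mulrS Defs.coefD IH. Qed.

(** A larger least exponent makes [x] infinitesimal relative to [y], so no integer factor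
    matters. *)
Lemma mulrn_lt_alpha_min x y k : 0 < x -> 0 < y -> alpha_min y < alpha_min x ->
  x *+ k < y.
Proof.
move=> x0 y0 yx; rewrite -subr_gt0.
have xk : exp_lb (x *+ k) (alpha_min x).
  by move=> d; rewrite hahn_coefMn mulrn_eq0 negb_or => /andP[_]; exact: exp_lb_alpha.
have ym : exp_lb (y - x *+ k) (alpha_min y).
  move=> d; have [/exp_lb_alpha//|/negPn/eqP y0d] := boolP (y d != 0).
  by rewrite Defs.coefB y0d sub0r oppr_eq0 => /xk; apply: le_trans; exact: ltW.
apply: (gt0_coef ym); rewrite Defs.coefB (_ : (x *+ k) _ = 0) ?subr0 ?coef_alpha_gt0//.
by apply/eqP; apply: contraTT yx => /xk; rewrite leNgt.
Qed.

Lemma exp_lb_dotr n (f x : 'rV[hahn R]_n) (a : 'I_n -> R) m :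
  (forall j, exp_lb (f 0 j) (a j)) -> (forall j, exp_lb (x 0 j) (m - a j)) ->
  exp_lb (dotr f x) m.
Proof.
move=> fa xa; apply: exp_lb_sum => j; rewrite -[m](subrK (a j)) addrC.
exact: exp_lbM.
Qed.

Lemma coef_dotr n (f x : 'rV[hahn R]_n) (a : 'I_n -> R) m :
  (forall j, exp_lb (f 0 j) (a j)) -> (forall j, exp_lb (x 0 j) (m - a j)) ->
  dotr f x m = \sum_j f 0 j (a j) * x 0 j (m - a j).
Proof.
move=> fa xa; rewrite hahn_coef_sum; apply: eq_bigr => j _.
by rewrite -[RHS]coefM_lb// addrC subrK.
Qed.

End LowestTerm.

Section Halfspaces.
Context (R : realType) (n : nat).
Implicit Types (f X : 'rV[hahn R]_n).

(** The negative term at [k] dominates: [n] times any other term is at most [b], so [n] times the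
    whole sum is at most [(n - 1) b - n b]. *)
Lemma dotr_lt0 f X k : positive_vec X -> f 0 k < 0 ->
  (forall j, 0 < f 0 j -> alpha_min (f 0 k) + alpha_min (X 0 k) <
                          alpha_min (f 0 j) + alpha_min (X 0 j)) ->
  dotr f X < 0.
Proof.
move=> X0 fk h; pose b := - (f 0 k * X 0 k).
have b0 : 0 < b by rewrite oppr_gt0 nmulr_rlt0.
have n0 : (0 < n)%N := leq_ltn_trans (leq0n k) (ltn_ord k).
have jb j : (f 0 j * X 0 j) *+ n <= b.
  have [fj|fj] := ltP 0 (f 0 j); last first.
    by apply: le_trans (ltW b0); rewrite mulrn_wle0// pmulr_lle0.
  have X_neq0 i : X 0 i != 0 by rewrite gt_eqF ?X0.
  apply/ltW/mulrn_lt_alpha_min => //; first by rewrite mulr_gt0.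
  by rewrite alpha_minN !alpha_minM ?h// ?(lt_eqF fk) ?(gt_eqF fj).
rewrite -(pmulrn_llt0 _ n0) /dotr (bigD1 k)//= mulrnDl -/b.
have : (\sum_(i < n | i != k) f 0 i * X 0 i) *+ n <= b *+ n.-1.
  rewrite -sumrMnl; apply: le_trans (ler_sum _ (fun j _ => jb j)) _.
  by rewrite sumr_const cardC1 card_ord.
have -> : (f 0 k * X 0 k) *+ n = - (b *+ n.-1) - b.
  have mulrn_pred (t : hahn R) : t *+ n = t *+ n.-1 + t by rewrite -mulrSr prednK.
  by rewrite mulrn_pred /b mulNrn !opprK.
lra.
Qed.

Lemma val_image_excludes f (x : 'rV[R]_n) k : f 0 k < 0 ->
  (forall j, 0 < f 0 j ->
    x 0 j - alpha_min (f 0 j) < x 0 k - alpha_min (f 0 k)) ->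
  ~ val_image [set X | 0 <= lin_form f X]%classic (tp_pi x).
Proof.
move=> fk h [X [fX X0] /tp_piP[c Xx]].
have aX j : alpha_min (X 0 j) = - (x 0 j + c).
  by rewrite -Xx mxE fine_hval ?opprK// gt_eqF ?X0.
have : dotr f X < 0.
  by apply: (dotr_lt0 X0 fk) => j fj; rewrite !aX; have := h j fj; lra.
by rewrite ltNge => /negP; apply.
Qed.

Lemma val_image_tropical f : (forall i, f 0 i != 0) ->
  (exists i, 0 < f 0 i) -> (exists j, f 0 j < 0) ->
  tropical_halfspace (val_image [set X | 0 <= lin_form f X]%classic).
Proof.
move=> f_neq0 [i0 fi0] [j0 fj0].
pose I := [set i | 0 < f 0 i]; pose J := [set j | f 0 j < 0].
pose c i := - alpha_min (f 0 i).
exists I, J, c; split.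
- by split; apply/set0Pn; [exists i0|exists j0]; rewrite inE.
- by apply/setP => i; rewrite !inE; case: (ltgtP 0 (f 0 i)) (f_neq0 i) => // <-; rewrite eqxx.
- by apply/setP => i; rewrite !inE; case: (ltgtP 0 (f 0 i)).
apply/seteqP; split => [P [X [fX X0] <-]|P [x hx <-]].
  exists (hvalv X) => //=; apply: bigmax_le; first exact: leNye.
  move=> j; rewrite inE => fj; rewrite leNgt; apply/negP => /bigmax_ltP[_ h].
  have : dotr f X < 0; last by rewrite ltNge => /negP; apply.
  apply: (dotr_lt0 X0 fj) => i fi; have := h i; rewrite inE fi => /(_ isT).
  rewrite lte_fin !mxE !fine_hval ?gt_eqF ?X0// /c.
  by lra.
have Ii0 : i0 \in I by rewrite inE.
have [i Ii im] := exists_argmax (P := fun i => i \in I) (fun i => c i + x 0 i) Ii0.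
have fi : 0 < f 0 i by move: Ii; rewrite inE.
have jm j : c j + x 0 j <= c i + x 0 i.
  have [jI|jI] := boolP (j \in I); first exact: im.
  have jJ : j \in J by move: jI (f_neq0 j); rewrite !inE; case: ltgtP.
  have : ((c j + x 0 j)%:E <= (c i + x 0 i)%:E)%E; last by rewrite lee_fin.
  apply: le_trans (le_bigmax_cond _ (fun j => (c j + x 0 j)%:E) jJ) _.
  apply: le_trans hx _; apply: bigmax_le; first exact: leNye.
  by move=> k kI; rewrite lee_fin im.
pose lead j := f 0 j (alpha_min (f 0 j)).
have lead_i : 0 < lead i by exact: coef_alpha_gt0.
(* Several terms may share the lowest exponent; the factor [M] on [I] lets the positive one at [i]
   outweigh all negative leading coefficients. *)
pose M := (1 + \sum_j `|lead j|) / lead i.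
have M_gt0 : 0 < M by rewrite divr_gt0// ltr_pwDl// sumr_ge0.
pose X : 'rV[hahn R]_n := \row_j hmono (if j \in I then M else 1) (- x 0 j).
have coefX_gt0 j : 0 < (if j \in I then M else 1) by case: ifP.
have X0 : positive_vec X by move=> j; rewrite mxE hmono_gt0.
exists X; last first.
  congr tp_pi; apply/rowP => j; rewrite !mxE fine_hval ?gt_eqF ?hmono_gt0//.
  by rewrite alpha_min_hmono ?opprK// gt_eqF.
split => //=; pose m := - (c i + x 0 i).
have Xm j : exp_lb (X 0 j) (m - alpha_min (f 0 j)).
  rewrite mxE; apply: exp_lbW (@exp_lb_hmono _ _ _).
  by rewrite /m; have := jm j; rewrite /c; lra.
have fa j : exp_lb (f 0 j) (alpha_min (f 0 j)) by exact: exp_lb_alpha.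
apply/ltW/(gt0_coef (exp_lb_dotr fa Xm)); rewrite (coef_dotr fa Xm) (bigD1 i)//= -/(lead i).
have -> : X 0 i (m - alpha_min (f 0 i)) = M.
  by rewrite mxE coef_hmono Ii ifT//; apply/eqP; rewrite /m /c; lra.
rewrite /M mulrC divfK ?gt_eqF// (bigD1 i)//= -addrA -addrA.
apply: ltr_pwDl => //; apply: addr_ge0 => //.
rewrite -big_split/=; apply: sumr_ge0 => j ji; rewrite -/(lead j).
rewrite mxE coef_hmono; case: ifP => _; last by rewrite mulr0 addr0.
case: ifP => jI; last first.
  by rewrite mulr1 -lerBlDr sub0r; have := ler_norm (- lead j); rewrite normrN.
rewrite addr_ge0// mulr_ge0//; last exact: ltW.
by apply/ltW/coef_alpha_gt0; move: jI; rewrite inE.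
Qed.

End Halfspaces.

(** * Facets of a lift *)

Lemma enum_val_ltn (p : nat) (A : {set 'I_p}) (a b : 'I_#|A|) :
  (a < b)%N -> (enum_val a < enum_val b)%N.
Proof.
move=> ab; have srt : sorted (fun i j : 'I_p => (i < j)%N) (enum A).
  rewrite /enum_mem; apply: sorted_filter; first by move=> ? ? ?; exact: ltn_trans.
  by have := iota_ltn_sorted 0 p; rewrite -val_enum_ord sorted_map enumT.
have p0 : 'I_p := enum_val a.
rewrite !(enum_val_nth p0); apply: (sorted_ltn_nth _ p0 srt) => //.
- by move=> ? ? ?; exact: ltn_trans.
- by rewrite inE -cardE.
- by rewrite inE -cardE.
Qed.

Section Facets.
Context (R : realType) (n p : nat) (w : 'I_p -> 'rV[hahn R]_n).
Context (n_ge2 : (2 <= n)%N) (w_gt0 : forall r, positive_vec (w r)).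
Implicit Types (f X : 'rV[hahn R]_n).

(** The maximal minors of the generators with one coordinate deleted; they control zero coordinates
    of facet normals. *)
Definition nonzero_minors := forall (i : 'I_n) (g : 'I_n.-1 -> 'I_p),
  (forall a b : 'I_n.-1, (a < b)%N -> (g a < g b)%N) ->
  \det (\matrix_(a, b) w (g b) 0 (lift i a)) != 0.

Lemma conic_hull_generator r : conic_hull w (w r).
Proof.
exists (fun s => if s == r then 1 else 0); split => [s|].
  by case: ifP => // _; exact: ler01.
rewrite (bigD1 r)//= eqxx scale1r big1 ?addr0// => s /negbTE->.
by rewrite scale0r.
Qed.

Lemma conic_hull_halfspace f : (forall r, 0 <= dotr f (w r)) ->
  (conic_hull w `<=` [set X | 0 <= lin_form f X])%classic.
Proof.
move=> fw _ [mu [mu0 ->]] /=; rewrite -[lin_form f _]/(dotr f _) dotr_sumr.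
by apply: sumr_ge0 => r _; rewrite dotrZr mulr_ge0.
Qed.

Lemma face_sub_span f : (forall r, 0 <= dotr f (w r)) ->
  (conic_hull w `&` [set X | lin_form f X = 0] `<=`
   [set X | X \in <<[seq w r | r in tight w f]>>%VS])%classic.
Proof.
move=> fw _ [[mu [mu0 ->]] /= fX]; rewrite memv_suml// => r _.
have [rt|rt] := boolP (r \in tight w f).
  by rewrite memvZ// memv_span//; apply/imageP; exists r.
move: fX; rewrite -[lin_form f _]/(dotr f _) dotr_sumr => /eqP.
rewrite psumr_eq0 => [/allP/(_ r)|s _]; last by rewrite dotrZr mulr_ge0.
rewrite mem_index_enum => /(_ isT); rewrite dotrZr mulf_eq0 => /orP[/eqP->|fr].
  by rewrite scale0r mem0v.
by case/negP: rt; rewrite inE.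
Qed.

Lemma facet_halfspace_tight f : (forall h, (forall r, dotr h (w r) = 0) -> h = 0) ->
  f != 0 -> (forall r, 0 <= dotr f (w r)) -> (n.-1 <= \rank (tight_mx w f))%N ->
  facet_halfspace (conic_hull w) [set X | 0 <= lin_form f X]%classic.
Proof.
move=> span f0 fw rf; exists f; split => //; first exact: conic_hull_halfspace.
exists <<[seq w r | r in tight w f]>>%VS; split.
- exact: face_sub_span.
- move=> W hW; apply/span_subvP => x /imageP[r]; rewrite inE => /eqP fr ->.
  by apply: hW; split => //; exact: conic_hull_generator.
- exact: dim_span_tight.
Qed.

(** A facet has at least [n - 1] tight generators. If [f 0 i] were 0, the other coordinates of [f]
    would form a kernel vector of a minor omitting [i]. Both signs occur because [f] vanishes on a
    positive generator. *)
Lemma facet_halfspaceP (minors : nonzero_minors) H :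
  facet_halfspace (conic_hull w) H -> exists f,
  [/\ H = [set X | 0 <= lin_form f X]%classic, forall i, f 0 i != 0,
      exists i, 0 < f 0 i & exists j, f 0 j < 0].
Proof.
move=> [f [f_neq0 -> PH [U [SU Umin dU]]]]; exists f.
have fw r : 0 <= dotr f (w r) by exact/PH/conic_hull_generator.
have tn : (n.-1 <= #|tight w f|)%N.
  rewrite -dU; apply: leq_trans (dimvS (Umin _ (face_sub_span fw))) _.
  by apply: leq_trans (dim_span _) _; rewrite size_image.
have tP r : r \in tight w f -> dotr f (w r) = 0 by rewrite inE => /eqP.
have f0 i : f 0 i != 0.
  apply/eqP => fi; pose g b : 'I_p := enum_val (widen_ord tn b).
  have /negP := @minors i g (fun a b ab => enum_val_ltn (ab : (widen_ord tn a < widen_ord tn b)%N)).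
  apply; apply/det0P; exists (\row_a f 0 (lift i a)).
    apply: contraNneq f_neq0 => h; apply/eqP/rowP => j; rewrite mxE.
    case: (unliftP i j) => [k|] ->; last exact: fi.
    by move/rowP: h => /(_ k); rewrite !mxE.
  apply/rowP => b; rewrite !mxE -[RHS](tP _ (enum_valP (widen_ord tn b))).
  rewrite -/(g b) /dotr [RHS](bigD1 i)//= fi mul0r add0r.
  rewrite [RHS](reindex_onto (lift i) (fun j => odflt b (unlift i j))); last first.
    by move=> j ji; case: (unliftP i j) ji => [k ->//|->]; rewrite eqxx.
  apply: eq_big => [a|a _]; last by rewrite !mxE.
  by rewrite liftK eqxx andbT eq_sym neq_lift.
have [r rt] : exists r, r \in tight w f.
  by apply/set0Pn; rewrite -card_gt0; apply: leq_trans tn; lia.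
have n0 : (0 < n)%N by lia.
have fr := tP r rt; have wr := w_gt0 r.
split => //; apply: contrapT => /forallNP h.
  have : dotr f (w r) < 0; last by rewrite fr ltxx.
  rewrite /dotr (bigD1 (Ordinal n0))//= ltr_nwDl//.
    by rewrite pmulr_llt0// lt_neqAle f0 leNgt; apply/negP.
  by apply: sumr_le0 => i _; rewrite pmulr_lle0// leNgt; apply/negP.
have : 0 < dotr f (w r); last by rewrite fr ltxx.
rewrite /dotr (bigD1 (Ordinal n0))//= ltr_pwDl//.
  by rewrite pmulr_lgt0// lt_neqAle eq_sym f0 leNgt; apply/negP.
by apply: sumr_ge0 => i _; rewrite pmulr_lge0// leNgt; apply/negP.
Qed.

End Facets.

(** * A criterion for a lift in terms of leading coefficients *)

Section Tropicalize.
Context (R : realType) (n p : nat) (w : 'I_p -> 'rV[hahn R]_n).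
Context (v : 'I_p -> TP R n).
Context (n_ge2 : (2 <= n)%N) (p_gt0 : (0 < p)%N).
Context (w_gt0 : forall r, positive_vec (w r)) (wv : forall r, tp_pi (hvalv (w r)) = v r).

Definition vals r i : R := - alpha_min (w r 0 i).
Definition lead r i : R := w r 0 i (alpha_min (w r 0 i)).

(* The ratio of leading coefficients [lead r t / lead r i] is far from maximal for
   one of [t = k] and [t = l]. *)
Definition leads_dominated := forall y (S : {set 'I_n}) i r k l,
  covered vals y -> (forall s, ~~ (top vals y s \subset S)) ->
  top vals y r \subset i |: S -> k \in S -> l \in S ->
  k \in top vals y r -> l \in top vals y r -> k != l ->
  exists t q, [/\ (t == k) || (t == l), top vals y q \subset i |: S,
    t \in top vals y q &
    (4 * n ^ 2)%:R * lead r t * lead q i <= lead q t * lead r i].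

Let n_gt0 : (0 < n)%N. Proof. by lia. Qed.

Lemma tp_pi_vals r : tp_pi (\row_i vals r i) = v r.
Proof.
rewrite -wv; congr tp_pi; apply/rowP => i; rewrite !mxE fine_hval//.
by rewrite gt_eqF ?w_gt0.
Qed.

(** A tropical combination lifts to the same combination with monomial coefficients: all leading
    coefficients are positive, so nothing cancels, and the result lies in the cone. *)
Lemma polytope_sub_val_image (x : 'rV[R]_n) f : covered vals (x 0) ->
  (forall r, 0 <= dotr f (w r)) ->
  val_image [set X | 0 <= lin_form f X]%classic (tp_pi x).
Proof.
move=> xc fw; have /choice[m mP] : forall r, exists m,
    forall j, m <= x 0 j - vals r j /\ (j \in top vals (x 0) r -> m = x 0 j - vals r j).
  move=> r; have [i ir] := top_exists vals (x 0) r (Ordinal n_gt0).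
  exists (x 0 i - vals r i) => j; split; first by have /topP/(_ j) := ir; lra.
  by move=> jr; have := top_eq ir jr; lra.
pose X := \sum_r hmono 1 (- m r) *: w r.
have Xlb j : exp_lb (X 0 j) (- x 0 j).
  rewrite summxE; apply: exp_lb_sum => r; rewrite mxE.
  apply: exp_lbW (exp_lbM (@exp_lb_hmono _ _ _) (@exp_lb_alpha _ _)).
  by have [] := mP r j; rewrite /vals; lra.
have Xlead j : 0 < X 0 j (- x 0 j).
  have [r jr] := xc j; rewrite summxE hahn_coef_sum (bigD1 r)//= ltr_pwDl//.
    have -> : - x 0 j = - m r + alpha_min (w r 0 j).
      by rewrite ((mP r j).2 jr) /vals; lra.
    rewrite mxE coefM_lb; [|exact: exp_lb_hmono|exact: exp_lb_alpha].
    by rewrite coef_hmono eqxx mul1r coef_alpha_gt0// w_gt0.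
  apply: sumr_ge0 => s _; rewrite mxE; apply: coef_ge0.
    apply: exp_lbW (exp_lbM (@exp_lb_hmono _ _ _) (@exp_lb_alpha _ _)).
    by have [] := mP s j; rewrite /vals; lra.
  by rewrite mulr_ge0// ltW ?hmono_gt0// w_gt0.
exists X; last first.
  congr tp_pi; apply/rowP => j; rewrite mxE fine_hval; last first.
    by rewrite gt_eqF// (gt0_coef (Xlb j)).
  rewrite (@alpha_minE _ _ (- x 0 j)) ?opprK//; split; last exact: Xlb.
  by rewrite gt_eqF.
split; last by move=> j; exact: gt0_coef (Xlb j) (Xlead j).
rewrite /= -[lin_form f X]/(dotr f X) dotr_sumr.
by apply: sumr_ge0 => r _; rewrite dotrZr mulr_ge0// ltW// hmono_gt0.
Qed.

Section Residue.
Context (acc : accessible vals).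
Context (y : 'I_n -> R) (yc : covered vals y).

Let tops r j : j \in top vals y r -> exists m, forall k,
  (m - y k <= alpha_min (w r 0 k)) /\
  ((alpha_min (w r 0 k) == m - y k) = (k \in top vals y r)).
Proof.
move=> jr; exists (alpha_min (w r 0 j) + y j) => k.
have /topP jm := jr; split; first by have := jm k; rewrite /vals; lra.
apply/eqP/idP => [e|kr]; last by have := top_eq jr kr; rewrite /vals; lra.
by apply/topP => l; have := jm l; move: e; rewrite /vals; lra.
Qed.

(** After coordinate [j] is rescaled by [t^(y j)], the lowest exponent of generator [r] occurs
    exactly at its touched coordinates. *)
Lemma residue_exists : exists (m : 'I_p -> R), forall r,
  (forall j, exp_lb (w r 0 j) (m r - y j)) /\
  forall j, w r 0 j (m r - y j) = if j \in top vals y r then lead r j else 0.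
Proof.
suff /choice[m mP] : forall r, exists m,
  (forall j, exp_lb (w r 0 j) (m - y j)) /\
  forall j, w r 0 j (m - y j) = if j \in top vals y r then lead r j else 0.
  by exists m.
move=> r; have [j jr] := top_exists vals y r (Ordinal n_gt0).
have [m mP] := tops jr; exists m; split => k; have [km ke] := mP k.
  exact: exp_lbW km (@exp_lb_alpha _ _).
rewrite -ke; case: eqP => [<-//|/eqP ne]; apply/eqP; apply: contraT.
by move=> /exp_lb_alpha => h; case/eqP: ne; apply/eqP; rewrite eq_le h km.
Qed.

Lemma residue_normal (h : 'rV[hahn R]_n) : h != 0 -> exists b,
  (forall j, exp_lb (h 0 j) (b + y j)) /\ exists j, h 0 j (b + y j) != 0.
Proof.
move=> h0; have [i hi] : exists i, h 0 i != 0.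
  apply: contrapT => /forallNP hN; case/eqP: h0; apply/rowP => j; rewrite mxE.
  by apply/eqP; apply/negPn/negP; exact: hN.
have [j hj jm] := exists_argmax (P := fun j => h 0 j != 0)
  (fun j => - (alpha_min (h 0 j) - y j)) hi.
exists (alpha_min (h 0 j) - y j); split => [k|].
  have [->|hk] := eqVneq (h 0 k) 0; first exact: exp_lb0.
  by apply: exp_lbW (@exp_lb_alpha _ _); have := jm k hk; lra.
by exists j; rewrite subrK; have [] := alpha_minP hj.
Qed.

(** Along a chain given by accessibility the system is triangular: the generator touching [b] within
    [B] otherwise touches only coordinates where [f] already vanishes. *)
Lemma feasible_span (A : 'I_p -> 'I_n -> R) :
  (forall r j, j \in top vals y r -> 0 < A r j) ->
  (forall r j, j \notin top vals y r -> A r j = 0) ->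
  forall f, (forall r, \sum_j f j * A r j = 0) -> forall j, f j = 0.
Proof.
move=> A1 A0 f fA.
suff h B : feasible vals y B -> forall j, j \in B -> f j = 0.
  by move=> j; apply: (h [set: 'I_n]) => // i _; have [r ir] := yc i; exists r.
move: {2}#|B| (leqnn #|B|) => m; elim: m B => [|m IH] B Bm Bf j jB.
  by move: Bm; rewrite leqn0 cards_eq0 => /eqP B0; rewrite B0 inE in jB.
have [|b bB bf] := acc yc Bf; first by apply/set0Pn; exists j.
have fB k : k \in B :\ b -> f k = 0.
  by apply: IH => //; move: Bm; rewrite (cardsD1 b B) bB.
have [->|jb] := eqVneq j b; last by apply: fB; rewrite in_setD1 jb.
have [r [br rB]] := Bf b bB; have := fA r; rewrite (bigD1 b)//= big1 => [|k kb].
  by rewrite addr0 => /eqP; rewrite mulf_eq0 (gt_eqF (A1 _ _ br)) orbF => /eqP.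
have [kr|kr] := boolP (k \in top vals y r); last by rewrite A0// mulr0.
by rewrite fB ?mul0r// in_setD1 kb (subsetP rB).
Qed.

End Residue.

Lemma facets_tropicalize_dominated : nonzero_minors w -> accessible vals ->
  leads_dominated -> facets_tropicalize v (conic_hull w).
Proof.
move=> minors acc dom; split.
  by move=> H /(facet_halfspaceP n_ge2 w_gt0 minors)[f [-> f0 fp fn]]; exact: val_image_tropical.
apply/seteqP; split => P; last first.
  move=> vP H [f [_ -> PH _]]; have fw r : 0 <= dotr f (w r).
    exact/PH/conic_hull_generator.
  rewrite -(tp_reprK P); apply: polytope_sub_val_image => //.
  by apply/(tropical_polytopeP tp_pi_vals n_gt0); rewrite tp_reprK.
move=> hP; rewrite -(tp_reprK P); apply/(tropical_polytopeP tp_pi_vals n_gt0).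
apply: contrapT => /(sep_point acc p_gt0 n_gt0)[y [i]].
set S := argmaxs _ _ => -[yc yS [r0 r0i] Scov].
have [m mP] := residue_exists y.
pose A r j := w r 0 j (m r - y j).
have AE r j : A r j = if j \in top vals y r then lead r j else 0 by exact: (mP r).2.
have A1 r j : j \in top vals y r -> 0 < A r j.
  by move=> jr; rewrite AE jr coef_alpha_gt0// w_gt0.
have A0 r j : j \notin top vals y r -> A r j = 0 by rewrite AE => /negbTE->.
have sp := feasible_span acc yc A1 A0.
have S0 : S != set0 by exact: argmaxs_neq0 (Ordinal n_gt0).
have [|f0 [q [f0A f0q fS]]] := residue_separation A1 A0 S0 yS (ex_intro _ r0 r0i) Scov _ sp.
  move=> r k l rS kS lS kr lr kl.
  have [t [s [tkl sS ts le_ts]]] := dom y S i r k l yc yS rS kS lS kr lr kl.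
  have iT u : top vals y u \subset i |: S -> i \in top vals y u.
    by move/mem_subU1; exact.
  exists t, s; split => //; rewrite !AE ts !iT//.
  by have -> : t \in top vals y r; first case/orP: tkl => /eqP ->.
have wlb r := (mP r).1.
(* A nonzero [h] has a nonzero residue, which would be orthogonal to all residues of the
   generators. *)
have spK (h : 'rV[hahn R]_n) : (forall r, dotr h (w r) = 0) -> h = 0.
  move=> hw; apply/eqP; apply: contraT => /(residue_normal y)[b [hb [j /eqP[]]]].
  apply: (sp (fun j => h 0 j (b + y j))) => r.
  have wb k : exp_lb (w r 0 k) ((b + m r) - (b + y k)).
    by rewrite (_ : _ - _ = m r - y k); [exact: wlb|ring].
  have := coef_dotr hb wb; rewrite hw Defs.coef0 => /esym; rewrite -[X in _ -> _ = X]/(0 : R) => e.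
  rewrite -[RHS]e; apply: eq_bigr => k _; congr (_ * _); rewrite /A.
  by congr (w r 0 k _); ring.
(* Monomial lifts of [f0] and [q] with the exponents dual to each other; strict signs of the
   residues pass to the Hahn field. *)
pose fK : 'rV[hahn R]_n := \row_j hmono (f0 j) (y j).
pose qK : 'rV[hahn R]_n := \row_j hmono (q j) (- y j).
have fKlb j : exp_lb (fK 0 j) (y j) by rewrite mxE; exact: exp_lb_hmono.
have qKlb b j : exp_lb (qK 0 j) (b - (b + y j)).
  by rewrite mxE (_ : b - _ = - y j); [exact: exp_lb_hmono|ring].
have qKE b j : qK 0 j (b - (b + y j)) = q j.
  by rewrite mxE coef_hmono (_ : b - _ = - y j) ?eqxx//; ring.
have fKE j : fK 0 j (y j) = f0 j by rewrite mxE coef_hmono eqxx.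
have fKw r : 0 <= dotr fK (w r).
  apply/ltW/(gt0_coef (exp_lb_dotr fKlb (wlb r))); rewrite (coef_dotr fKlb (wlb r)).
  by under eq_bigr do rewrite fKE; exact: f0A.
have fKq : dotr fK qK < 0.
  have lb0 j : exp_lb (qK 0 j) (0 - y j) by rewrite -(add0r (y j)); exact: qKlb.
  apply: (lt0_coef (exp_lb_dotr fKlb lb0)); rewrite (coef_dotr fKlb lb0).
  rewrite (eq_bigr (fun j => f0 j * q j)) => [//|j _].
  by rewrite fKE mxE coef_hmono sub0r eqxx.
have [f [fw fq rf]] := exists_facet_normal spK fKw fKq.
have f_neq0 : f != 0.
  by apply: contraTneq fq => ->; rewrite /dotr big1 ?ltxx// => j _; rewrite mxE mul0r.
have [b [fb [j0 fj0]]] := residue_normal y f_neq0.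
have wb r k : exp_lb (w r 0 k) ((b + m r) - (b + y k)).
  by rewrite (_ : _ - _ = m r - y k); [exact: wlb|ring].
(* The residue of the facet normal satisfies the weak inequalities of [residue_separation], which
   then forces strict signs on [S]. *)
have fr_neg : forall k, k \in S -> f 0 k (b + y k) < 0.
  apply: (fS (fun k => f 0 k (b + y k))); first by exists j0.
    move=> r; have := coef_ge0 (exp_lb_dotr fb (wb r)) (fw r).
    rewrite (coef_dotr fb (wb r)); congr (0 <= _); apply: eq_bigr => k _.
    by congr (_ * w r 0 k _); ring.
  have := coef_le0 (exp_lb_dotr fb (qKlb b)) (ltW fq).
  rewrite (coef_dotr fb (qKlb b)); congr (_ <= 0); apply: eq_bigr => k _.
  by rewrite qKE.
have f_neg k : k \in S -> f 0 k < 0 by move=> kS; exact: lt0_coef (fb k) (fr_neg k kS).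
have [k kS] : exists k, k \in S by exact/set0Pn.
have ak : alpha_min (f 0 k) = b + y k.
  by apply: alpha_minE; split; [rewrite lt_eqF// fr_neg|exact: fb].
have := hP _ (facet_halfspace_tight spK f_neq0 fw rf); rewrite -(tp_reprK P).
apply: (@val_image_excludes _ _ _ _ k); first exact: f_neg.
move=> j fj; have jS : j \notin S.
  by apply/negP => /f_neg; case: ltgtP fj.
have := argmaxs_lt kS jS; have := fb j (alpha_min (f 0 j)).
have [+ _] := alpha_minP (lt0r_neq0 fj) => /[swap] /[apply].
by rewrite ak; move: (alpha_min _) => a; lra.
Qed.

End Tropicalize.

(** * General position *)

Section GeneralPosition.
Context (R : realType) (n p : nat) (w : 'I_p -> 'rV[hahn R]_n).
Context (v : 'I_p -> TP R n) (gpv : general_position v).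
Context (w_gt0 : forall r, positive_vec (w r)) (wv : forall r, tp_pi (hvalv (w r)) = v r).

Lemma least_exp_prod (I : finType) (F : I -> hahn R) : (forall i, F i != 0) ->
  least_exp (\prod_i F i) (\sum_i alpha_min (F i)).
Proof.
move=> F0; apply: (big_ind2 (fun x m => least_exp x m)) => //.
- split; first by rewrite Defs.coef1 eqxx oner_eq0.
  by move=> a; rewrite Defs.coef1; case: (eqVneq a 0) => [->|_]; rewrite ?eqxx.
- by move=> ? ? ? ?; exact: least_expM.
- by move=> i _; exact: alpha_minP.
Qed.

(** The term of the unique optimal permutation has strictly the lowest exponent, so it cannot be
    cancelled. *)
Lemma tropically_nonsingular_det m (M : 'M[hahn R]_m) : (forall a b, M a b != 0) ->
  ~ tropically_singular (\matrix_(a, b) - alpha_min (M a b)) -> \det M != 0.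
Proof.
move=> M0; pose U s := \sum_a - alpha_min (M a (fun_of_perm s a)).
have UE (s : 'S_m) : \sum_a (\matrix_(a, b) - alpha_min (M a b)) a (s a) = U s.
  by apply: eq_bigr => a _; rewrite mxE.
move=> nsing.
have [s _ smax] := exists_argmax (i0 := 1%g : 'S_m) (P := xpredT) U isT.
have slt t : t != s -> U t < U s.
  move=> ts; rewrite lt_neqAle smax// andbT; apply/eqP => Uts; apply: nsing.
  by exists t, s; split => // r; rewrite !UE Uts !smax.
have le (t : 'S_m) : least_exp (\prod_a M a (t a)) (- U t).
  have := least_exp_prod (fun a => M0 a (t a)).
  by rewrite (_ : - U t = \sum_a alpha_min (M a (t a)))// /U sumrN opprK.
suff : (\det M) (- U s) != 0 by apply: contraNneq => ->; rewrite Defs.coef0.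
rewrite /determinant hahn_coef_sum (big_only1 s) // => [|t ts _].
  rewrite mulr_sign; case: ifP => _; rewrite ?Defs.coefN ?oppr_eq0.
    by have [] := le s.
  by have [] := le s.
have z : (\prod_a M a (t a)) (- U s) = 0.
  by apply: (coef_lt_least (le t)); rewrite ltrN2 slt.
by rewrite mulr_sign; case: ifP => _; rewrite ?Defs.coefN z ?oppr0.
Qed.

Lemma tp_repr_vals : exists c : 'I_p -> R, forall r i,
  tp_repr (v r) 0 i = vals w r i + c r.
Proof.
have /choice[c cP] : forall r, exists c, forall i,
    tp_repr (v r) 0 i = vals w r i + c.
  move=> r; have : tp_pi (tp_repr (v r)) = tp_pi (\row_i vals w r i).
    by rewrite tp_reprK (tp_pi_vals w_gt0 wv).
  by move=> /tp_piP[c cP]; exists c => i; rewrite cP mxE.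
by exists c.
Qed.

Lemma general_position_minors : nonzero_minors w.
Proof.
move=> i g g_inc; apply: tropically_nonsingular_det.
  by move=> a b; rewrite mxE gt_eqF ?w_gt0.
have [c cP] := tp_repr_vals.
move=> [s [t [st h]]]; apply: (gpv _ g_inc).
  move=> a b ab; have : (lift i a < lift i b)%N; last by exact.
  by rewrite /= /bump; move: ab; case: leqP; case: leqP; lia.
exists s, t; split => // r.
(* Changing representatives adds the same constant to the weight of every permutation. *)
have shift (u : 'S_n.-1) :
    \sum_a mxsub (lift i) g (\matrix_(j, q) tp_repr (v q) 0 j) a (u a) =
    \sum_a (\matrix_(a, b) - alpha_min ((\matrix_(a, b) w (g b) 0 (lift i a)) a b)) a (u a)
    + \sum_a c (g a).
  rewrite [X in _ + X](reindex_inj (@perm_inj _ u))/= -big_split/=.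
  by apply: eq_bigr => a _; rewrite !mxE cP /vals.
by rewrite !shift !lerD2r; exact: h.
Qed.

(** Equality would give both permutations of a 2 by 2 submatrix the same weight. The indices are
    first ordered, as submatrices are given by increasing maps. *)
Lemma general_position2 i t q r : i != t -> q != r ->
  vals w q i + vals w r t <> vals w q t + vals w r i.
Proof.
wlog it : i t / (i < t)%N => [H|].
  have [/H//|ti|/val_inj->] := ltngtP i t; last by rewrite eqxx.
  by rewrite eq_sym => /(H _ _ ti) h qr /esym; exact: h.
wlog qr : q r / (q < r)%N => [H|_ _ e].
  have [/H//|rq|/val_inj->] := ltngtP q r; last by rewrite eqxx.
  move=> ti; rewrite eq_sym => /(H _ _ rq ti) h e; apply: h.
  by rewrite addrC -e addrC.
have [c cP] := tp_repr_vals.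
pose f (a : 'I_2) := if a == ord0 then i else t.
pose g (a : 'I_2) := if a == ord0 then q else r.
have inc m (x y : 'I_m) : (x < y)%N -> forall a b : 'I_2, (a < b)%N ->
    ((if a == ord0 then x else y) < (if b == ord0 then x else y))%N.
  by move=> xy [[|[|a]]//= ?] [[|[|b]]//= ?].
apply: (gpv (inc _ _ _ it) (inc _ _ _ qr)).
set U := mxsub _ _ _.
have sumU (s : 'S_2) : \sum_a U a (s a) = U 0 0 + U 1 1.
  rewrite big_ord_recl big_ord1 (_ : lift ord0 ord0 = 1); last exact/val_inj.
  have s01 : s 0 != s 1 by rewrite (inj_eq perm_inj).
  have I2 (a : 'I_2) : (a == 0) || (a == 1) by case: a => [[|[|]]].
  rewrite -[ord0]/(0 : 'I_2).
  have := I2 (s 0); have := I2 (s 1).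
  move=> /orP[]/eqP e1 /orP[]/eqP e0; move: s01; rewrite e0 e1 ?eqxx// => _.
  by rewrite !mxE /= !cP; move: e; lra.
exists 1%g, (tperm 0 1); split; last by move=> s; rewrite !sumU.
by apply/eqP => /permP/(_ 0); rewrite perm1 tpermL.
Qed.

(** The premises are contradictory: a feasible set separating [k] from [l] inside the touched set of
    [r] yields another generator [q] that shares with [r] the touched coordinates [i] and some [t]
    in [S], hence a singular 2 by 2 submatrix. *)
Lemma general_position_dominated : accessible (vals w) -> leads_dominated w.
Proof.
move=> acc y S i r k l yc yS rS kS lS kr lr kl.
have rf : feasible (vals w) y (top (vals w) y r) by move=> j jr; exists r.
have [A [Af Ar Akl]] := feasible_separates acc yc rf kr lr kl.
have iT u : top (vals w) y u \subset i |: S -> i \in top (vals w) y u.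
  by move/mem_subU1; exact.
have iS : i \notin S := notin_subU1 rS (yS r).
have [t [t' [tA t'A t'r tr tS]]] : exists t t', [/\ t \in A, t' \notin A,
    t' \in top (vals w) y r, t \in top (vals w) y r & t \in S].
  by move: Akl; case: (boolP (k \in A)) => kA /= lA; [exists k, l|exists l, k].
have [q [tq qA]] := Af t tA.
have qr : q != r.
  by apply: contraNneq t'A => e; apply: (subsetP qA); rewrite e.
have qS : top (vals w) y q \subset i |: S := subset_trans qA (subset_trans Ar rS).
have it : i != t by apply: contraNneq iS => ->.
exfalso; apply: (general_position2 it qr).
have := top_eq (iT q qS) tq; have := top_eq (iT r rS) tr.
lra.
Qed.

End GeneralPosition.

(** * A lift of an arbitrary pure polytope *)

(** A left kernel vector [u] of this Cauchy matrix gives a polynomial [P] of degree below [m] with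
    the [m] roots [y b]. Hence [P] is 0, and its value at [- x a] is [u 0 a] times a nonzero
    product. *)
Lemma cauchy_det (F : fieldType) m (x y : 'I_m -> F) : injective x -> injective y ->
  (forall a b, x a + y b != 0) -> \det (\matrix_(a, b) (x a + y b)^-1) != 0.
Proof.
move=> xi yi xy; apply/negP => /det0P[u u0 uB].
pose P : {poly F} := \sum_a u 0 a *: \prod_(c | c != a) ('X + (x c)%:P).
have Py b : P.[y b] = 0.
  transitivity ((\prod_c (x c + y b)) * (u *m (\matrix_(a, b) (x a + y b)^-1)) 0 b).
    rewrite horner_sum mxE mulr_sumr; apply: eq_bigr => a _.
    rewrite hornerZ horner_prod mxE [in RHS](bigD1 a)//=.
    rewrite (eq_bigr (fun c => x c + y b)) => [|c _]; last first.
      by rewrite hornerD hornerX hornerC addrC.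
    by field; exact: xy.
  by rewrite uB mxE mulr0.
have sP : (size P <= m)%N.
  apply: leq_trans (size_sum _ _ _) _; apply/bigmax_leqP => a _.
  apply: leq_trans (size_scale_leq _ _) _.
  apply: leq_trans (size_poly_prod_leq _ _) _.
  rewrite (eq_bigr (fun=> 2%N)) => [|c _].
    rewrite sum_nat_const cardC1 card_ord.
    by have := ltn_ord a; lia.
  by rewrite size_XaddC.
have P0 : P = 0.
  apply/eqP; apply: contraT => Pn0.
  have := @max_poly_roots _ P [seq y b | b <- enum 'I_m] Pn0.
  rewrite size_map size_enum_ord ltnNge sP; apply.
    by apply/allP => _ /mapP[b _ ->]; rewrite rootE Py.
  by rewrite map_inj_uniq// enum_uniq.
case/eqP: u0; apply/rowP => a; rewrite mxE; have : P.[- x a] = 0 by rewrite P0 horner0.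
rewrite horner_sum (big_only1 a) // => [|c ca _]; last first.
  rewrite hornerZ horner_prod (bigD1 a) 1?eq_sym//= hornerD hornerX hornerC.
  by rewrite addNr mul0r mulr0.
rewrite hornerZ horner_prod => /eqP; rewrite mulf_eq0 => /orP[/eqP//|/prodf_eq0[c ca]].
rewrite hornerD hornerX hornerC addrC subr_eq0 => /eqP/xi ac.
by rewrite ac eqxx in ca.
Qed.

(** A determinant vanishes only if [s k] is an eigenvalue of [- U i (B i)^-1]; the product of the
    characteristic polynomials has finitely many roots. *)
Lemma generic_shift (F : fieldType) (I : finType) m (U B : I -> 'M[F]_m) (P : pred I)
  (s : nat -> F) : injective s -> (forall i, P i -> \det (B i) != 0) ->
  forall N, exists2 k, (N <= k)%N & forall i, P i -> \det (U i + s k *: B i) != 0.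
Proof.
move=> s_inj B0 N.
pose chi : {poly F} := \prod_(i | P i) char_poly (- (U i *m invmx (B i))).
have chi0 : chi != 0.
  by apply/prodf_neq0 => i _; rewrite -lead_coef_eq0 (eqP (char_poly_monic _)) oner_eq0.
have [k kN rk] : exists2 k, (N <= k)%N & ~~ root chi (s k).
  apply: contrapT => h.
  have := @max_poly_roots _ chi [seq s k | k <- iota N (size chi)] chi0.
  rewrite size_map size_iota ltnn => ff; suff : false by [].
  apply: ff; last by rewrite map_inj_uniq// iota_uniq.
  apply/allP => _ /mapP[k + ->]; rewrite mem_iota => /andP[kN _].
  by apply/negPn/negP => rk; apply: h; exists k.
exists k => // i Pi; apply: contra rk => /det0P[u u0 uU].
rewrite /root horner_prod prodf_seq_eq0; apply/hasP; exists i; first exact: mem_index_enum.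
rewrite Pi /= -[_ == 0]/(root _ _) -eigenvalue_root_char.
have Bu : B i \in unitmx by rewrite unitmxE unitfE B0.
apply/eigenvalueP; exists u => //.
move/eqP: uU; rewrite mulmxDr addr_eq0 => /eqP uU.
by rewrite mulmxN mulmxA uU mulNmx opprK -scalemxAr -scalemxAl mulmxK.
Qed.

(** * Heights of generators *)

Section Heights.
Context (R : realType) (n p : nat) (V : 'I_p -> 'I_n -> R).
Context (acc : accessible V).
Context (V_inj : forall q r, q != r -> ~ exists c, forall i, V q i = V r i + c).

(** After normalization at [i], the generators [s] in this sum lie below [r], so all summands are
    nonnegative and the inner sum is the l1-distance from [r] to [s]. *)
Definition height (r : 'I_p) (i : 'I_n) : R :=
  \sum_(s | i \in top V (V r) s) \sum_j ((V r j - V r i) - (V s j - V s i)).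

Let covered_self r : covered V (V r).
Proof. by move=> i; exists r; apply/topP => j; rewrite !subrr. Qed.

Let separate_self r (k l : 'I_n) : k != l -> exists A,
  feasible V (V r) A /\ (k \in A) (+) (l \in A).
Proof.
move=> kl; have f : feasible V (V r) [set: 'I_n].
  by move=> i _; have [s si] := covered_self r i; exists s.
have sep := feasible_separates acc (covered_self r) f.
by have [A [Af _ Akl]] := sep k l (in_setT k) (in_setT l) kl; exists A.
Qed.

(** Write [V u - y] as [(V u - V r) + (V r - y)]. Both summands are maximal at [j], so their sum is
    maximal exactly where both are. *)
Lemma top_localize y r u j : j \in top V (V r) u -> j \in top V y r ->
  top V y u = top V (V r) u :&: top V y r.
Proof.
move=> /topP ju /topP jr; apply/setP => z; rewrite in_setI; apply/topP/andP.
  move=> zu; have := zu j; have := ju z; have := jr z => h1 h2 h3.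
  by split; apply/topP => k; have := ju k; have := jr k; lra.
by move=> [/topP zu /topP zr] k; have := zu k; have := zr k; lra.
Qed.

Context (y : 'I_n -> R) (S : {set 'I_n}) (i : 'I_n).
Context (yS : forall s, ~~ (top V y s \subset S)).

Let iT u : top V y u \subset i |: S -> i \in top V y u.
Proof. by move/mem_subU1; exact. Qed.

Let top_self_i r u t : top V y r \subset i |: S -> t \in top V y r ->
  t \in top V (V r) u -> i \in top V (V r) u.
Proof.
move=> rS tr tu; have e := top_localize tu tr.
have : i \in top V y u by apply: iT; rewrite e (subset_trans (subsetIr _ _)).
by rewrite e => /setIP[].
Qed.

(** A generator touching [V r] at [t] also touches it at [i], and then contributes equally to both
    heights. *)
Let height_diff r t : top V y r \subset i |: S -> t \in top V y r ->
  height r i - height r t =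
  \sum_(s | (i \in top V (V r) s) && (t \notin top V (V r) s))
    \sum_j ((V r j - V r i) - (V s j - V s i)).
Proof.
move=> rS tr; rewrite /height (bigID (fun s => t \in top V (V r) s))/= addrAC.
rewrite -[RHS]add0r; congr (_ + _); apply/eqP; rewrite subr_eq0; apply/eqP.
apply: eq_big => [s|s /andP[si st]].
  by rewrite andbC; case: (boolP (t \in _)) => //= /(top_self_i rS tr).
by apply: eq_bigr => j _; have := top_eq si st; lra.
Qed.

(* Here [q] precedes [r] in the orders normalized at [i] and at [t], and the
   difference of heights is strictly increasing along such pairs. *)
Lemma height_gap r k l : top V y r \subset i |: S ->
  i \notin S -> k \in S -> l \in S -> k \in top V y r -> l \in top V y r -> k != l ->
  exists t q, [/\ (t == k) || (t == l), top V y q \subset i |: S, t \in top V y q &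
    height q i - height q t < height r i - height r t].
Proof.
move=> rS iS kS lS kr lr kl; have [A [Af Akl]] := separate_self r kl.
have [t [t' [tkl tA t'A tr tS]]] : exists t t', [/\ (t == k) || (t == l),
    t \in A, t' \notin A, t \in top V y r & t \in S].
  move: Akl; case: (boolP (k \in A)) => kA /= lA; [exists k, l|exists l, k]; split=> //.
  - by rewrite eqxx.
  - by rewrite eqxx orbT.
have [q [tq qA]] := Af t tA; exists t, q.
have e := top_localize tq tr.
have qS : top V y q \subset i |: S by rewrite e (subset_trans (subsetIr _ _)).
have tyq : t \in top V y q by rewrite e in_setI tq.
split => //.
have qr : q != r.
  apply: contraNneq t'A => qr; apply: (subsetP qA); rewrite qr.
  by apply/topP => j; rewrite !subrr.
have iq := top_self_i rS tr tq.
have D_gt0 : 0 < \sum_j ((V r j - V r i) - (V q j - V q i)).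
  have D_ge0 j : xpredT j -> 0 <= (V r j - V r i) - (V q j - V q i).
    by move=> _; have /topP/(_ j) := iq; lra.
  rewrite lt_neqAle sumr_ge0// andbT eq_sym psumr_eq0//.
  apply/negP => /allP h; apply: (V_inj qr); exists (V q i - V r i) => j.
  by have := h j (mem_index_enum _) => /eqP; lra.
have it : i != t by apply: contraNneq iS => ->.
(* This summand occurs for [q] and for [r], and grows by the positive distance between them; it
   makes the inequality strict. *)
have [s0 s0i s0t] : exists2 s, i \in top V (V q) s & t \notin top V (V q) s.
  have [A' [A'f]] := separate_self q it.
  case: (boolP (i \in A')) => /= iA' tA'.
    have [s [si sA']] := A'f i iA'; exists s => //.
    by apply: contra tA' => /(subsetP sA').
  have [s [st sA']] := A'f t tA'.
  by case/negP: iA'; apply: (subsetP sA'); exact: top_self_i qS tyq st.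
have DD s : \sum_j ((V r j - V r i) - (V s j - V s i)) =
  \sum_j ((V q j - V q i) - (V s j - V s i)) + \sum_j ((V r j - V r i) - (V q j - V q i)).
  by rewrite -big_split; apply: eq_bigr => j _ /=; ring.
have sub s : (i \in top V (V q) s) && (t \notin top V (V q) s) ->
    (i \in top V (V r) s) && (t \notin top V (V r) s).
  move=> /andP[si st]; have sri : i \in top V (V r) s.
    by apply/topP => j; move/topP: si => /(_ j); move/topP: iq => /(_ j); lra.
  rewrite sri /=; apply: contra st => srt; apply/topP => j.
  have := top_eq iq tq; have := top_eq sri srt; move/topP: si => /(_ j).
  by lra.
rewrite (height_diff qS tyq) (height_diff rS tr).
rewrite [ltLHS]big_mkcond [ltRHS]big_mkcond/= (bigD1 s0)//= [ltRHS](bigD1 s0)//=.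
have ps0 : (i \in top V (V q) s0) && (t \notin top V (V q) s0) by rewrite s0i.
rewrite ps0 (sub _ ps0); apply: ltr_leD; first by rewrite DD; lra.
apply: ler_sum => s _; case: ifP => [ps|_]; first by rewrite (sub _ ps) DD; lra.
case: ifP => // /andP[/topP si _]; apply: sumr_ge0 => j _.
by have := si j; lra.
Qed.

End Heights.

Lemma hmonoM (R : realType) (k l a b : R) :
  hmono k a * hmono l b = hmono (k * l) (a + b).
Proof.
apply: hahn_ext => c; rewrite Defs.coefM conv_monol !coef_hmono subr_eq [a + b]addrC.
by case: ifP; rewrite ?mulr0.
Qed.

Lemma hmono_natV (R : realType) k : (k.+1%:R : hahn R)^-1 = hmono (k.+1%:R)^-1 0.
Proof.
have -> : k.+1%:R = hmono k.+1%:R 0 :> hahn R.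
  by apply: hahn_ext => c; rewrite hahn_coefMn Defs.coef1 coef_hmono; case: ifP; rewrite ?mul0rn.
have e : hmono k.+1%:R 0 * hmono k.+1%:R^-1 0 = 1 :> hahn R.
  by rewrite hmonoM mulfV ?pnatr_eq0// addr0.
have h0 : hmono k.+1%:R 0 != 0 :> hahn R by rewrite gt_eqF// hmono_gt0// ltr0n.
by apply: (mulfI h0); rewrite e mulfV.
Qed.

(** * A lift with dominated leading coefficients and nonzero minors *)

Section SpecialLift.
Context (R : realType) (n p : nat) (v : 'I_p -> TP R n).
Context (v_inj : injective v).
Let V r i := tp_repr (v r) 0 i.
Context (acc : accessible V).

Let V_inj q r : q != r -> ~ exists c, forall i, V q i = V r i + c.
Proof.
move=> qr /tp_piP; rewrite !tp_reprK => /v_inj e.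
by rewrite e eqxx in qr.
Qed.

(** The leading terms, exponential in the height, give domination. A Cauchy matrix multiplied by a
    high power of [t] makes all the minors nonzero and leaves the leading terms unchanged. *)
Lemma special_lift : exists w : 'I_p -> 'rV[hahn R]_n,
  [/\ forall r, positive_vec (w r), forall r, tp_pi (hvalv (w r)) = v r,
    nonzero_minors w, accessible (vals w) & leads_dominated w].
Proof.
pose K : R := (4 * n ^ 2)%:R.
have [|e e0 he] := @finite_pos_lb R ('I_p * 'I_p * 'I_n * 'I_n)%type
  (fun t => let: (r, q, i, j) := t in
     height V q i - height V q j < height V r i - height V r j)
  (fun t => let: (r, q, i, j) := t in
     (height V r i - height V r j) - (height V q i - height V q j)).
  by move=> [[[r q] i] j]; rewrite subr_gt0.
(* Since [e] bounds all positive gaps from below, the exponential is at least [1 + K]. *)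
have {}he r q i j : height V q i - height V q j < height V r i - height V r j ->
    K <= expR (K / e * ((height V r i - height V r j) - (height V q i - height V q j))).
  move=> h; apply: le_trans (expR_ge1Dx _); have := he (r, q, i, j) h.
  move: (_ - _ - (_ - _)) => g eg; have : K <= K / e * g; last by lra.
  by rewrite mulrAC ler_pdivlMr// ler_wpM2l// ler0n.
pose a r i := expR (K / e * height V r i).
have ratio r q i j : height V q i - height V q j < height V r i - height V r j ->
    K * a r j * a q i <= a q j * a r i.
  move=> gap; rewrite -mulrA /a -!expRD.
  have -> : K / e * height V q j + K / e * height V r i =
    K / e * ((height V r i - height V r j) - (height V q i - height V q j)) +
    (K / e * height V r j + K / e * height V q i) by move: (K / e) => c; ring.
  by rewrite [leRHS]expRD ler_wpM2r ?expR_ge0// he.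
pose C r i : hahn R := ((i + r).+1%:R)^-1.
(* Any [k] beyond [N] puts the perturbation strictly above every leading exponent. *)
have [N hN] : exists N : nat, forall r i, - V r i < N%:R.
  pose b := \sum_(t : 'I_p * 'I_n) `|V t.1 t.2|.
  exists (Num.truncn b).+1 => r i; apply: le_lt_trans (truncnS_gt b).
  rewrite /b (bigD1 (r, i))//= -[leLHS]addr0 lerD//; last exact: sumr_ge0.
  by have := ler_norm (- V r i); rewrite normrN.
pose inc (g : {ffun 'I_n.-1 -> 'I_p}) :=
  [forall c : 'I_n.-1, forall d : 'I_n.-1, (c < d)%N ==> (g c < g d)%N].
have s_inj : injective (fun k : nat => hmono 1 k%:R : hahn R).
  move=> k l /(congr1 (@alpha_min R)); rewrite !alpha_min_hmono ?oner_eq0//.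
  by move/eqP; rewrite eqr_nat => /eqP.
have [|k kN hk] := @generic_shift (hahn R) ('I_n * {ffun 'I_n.-1 -> 'I_p})%type n.-1
  (fun t => \matrix_(c, d) hmono (a (t.2 d) (lift t.1 c)) (- V (t.2 d) (lift t.1 c)))
  (fun t => \matrix_(c, d) C (t.2 d) (lift t.1 c))
  (fun t => inc t.2) _ s_inj _ N.
  move=> [i g] /= gi.
  have g_inj : injective g.
    move=> c d gcd; apply/val_inj; move/forallP: gi => gi.
    case: (ltngtP c d) => // cd.
      by have /forallP/(_ d) := gi c; rewrite cd gcd ltnn.
    by have /forallP/(_ c) := gi d; rewrite cd gcd ltnn.
  pose x (c : 'I_n.-1) : hahn R := (lift i c)%:R; pose z (d : 'I_n.-1) : hahn R := (g d).+1%:R.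
  have -> : \matrix_(c, d) C (g d) (lift i c) = \matrix_(c, d) (x c + z d)^-1.
    by apply/matrixP => c d; rewrite !mxE /C /x /z -natrD addnS.
  apply: cauchy_det => [c d|c d|c d].
  - by rewrite /x => /eqP; rewrite eqr_nat => /eqP/val_inj/lift_inj.
  - by rewrite /z => /eqP; rewrite eqr_nat eqSS => /eqP/val_inj/g_inj.
  - by rewrite /x /z -natrD addnS pnatr_eq0.
pose w r : 'rV[hahn R]_n := \row_i (hmono (a r i) (- V r i) + hmono 1 k%:R * C r i).
have Clb r i : exp_lb (hmono 1 k%:R * C r i) k%:R.
  rewrite /C hmono_natV -[k%:R in X in exp_lb _ X]addr0.
  by apply: exp_lbM; exact: exp_lb_hmono.
have Vk r i : - V r i < k%:R by apply: lt_le_trans (hN r i) _; rewrite ler_nat.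
have wlb r i : exp_lb (w r 0 i) (- V r i).
  move=> d; rewrite mxE Defs.coefD => h; rewrite leNgt; apply: contra h => dV.
  rewrite coef_hmono ifF ?add0r; last exact: lt_eqF.
  apply: contraTT dV => /Clb.
  by rewrite -leNgt; apply: le_trans; exact: ltW.
have wV r i : w r 0 i (- V r i) = a r i.
  have z : (hmono 1 k%:R * C r i) (- V r i) = 0.
    by apply/eqP; apply: contraTT (Vk r i) => /Clb; rewrite -leNgt.
  by rewrite mxE Defs.coefD coef_hmono eqxx z addr0.
have a_gt0 r i : 0 < a r i by exact: expR_gt0.
have w_gt0 r : positive_vec (w r).
  by move=> i; apply: (gt0_coef (wlb r i)); rewrite wV.
have alw r i : alpha_min (w r 0 i) = - V r i.
  by apply: alpha_minE; split; [rewrite wV gt_eqF|exact: wlb].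
have leadE r i : lead w r i = a r i by rewrite /lead alw wV.
have valsw : vals w = V.
  by apply/funext => r; apply/funext => i; rewrite /vals alw opprK.
exists w; split => //.
- move=> r; rewrite -[RHS](tp_reprK (v r)); congr tp_pi; apply/rowP => i.
  by rewrite mxE fine_hval ?alw ?opprK// gt_eqF ?w_gt0.
- move=> i g g_inc; have := hk (i, finfun g).
  have -> : inc (finfun g).
    by apply/forallP => c; apply/forallP => d; apply/implyP => cd; rewrite !ffunE g_inc.
  move=> /(_ isT); congr (\det _ != 0); apply/matrixP => c d.
  by rewrite !mxE ffunE.
- by rewrite valsw.
rewrite /leads_dominated valsw => y S i r kk l yc yS rS kS lS kr lr kl.
have iS : i \notin S := notin_subU1 rS (yS r).
have [t [q [tkl qS tq gap]]] := height_gap acc V_inj yS rS iS kS lS kr lr kl.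
exists t, q; split; [exact: tkl|exact: qS|exact: tq|].
rewrite !leadE; exact: ratio gap.
Qed.

End SpecialLift.

Theorem theorem1 (R : realType) (n p : nat) (v : 'I_p -> TP R n) :
  (2 <= n)%N -> (1 <= p)%N -> injective v -> pure (tropical_polytope v) ->
  (exists P : set 'rV[hahn R]_n, is_lift v P /\ facets_tropicalize v P) /\
  (general_position v ->
   forall P : set 'rV[hahn R]_n, is_lift v P -> facets_tropicalize v P).
Proof.
move=> n2 p1 v_inj pv; have n_gt0 : (0 < n)%N by lia.
split.
  have acc : accessible (fun r i => tp_repr (v r) 0 i).
    apply: (@pure_accessible R n p v) => // r; rewrite -[RHS]tp_reprK; congr tp_pi.
    by apply/rowP => i; rewrite mxE.
  have [w [w0 wv minors accw dom]] := special_lift v_inj acc.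
  exists (conic_hull w); split; first by exists w.
  exact: facets_tropicalize_dominated.
move=> gp _ [w [w0 wv ->]].
have acc : accessible (vals w).
  by apply: (@pure_accessible R n p v) => // r; exact: tp_pi_vals.
apply: facets_tropicalize_dominated => //.
- exact: general_position_minors gp w0 wv.
- exact: general_position_dominated gp w0 wv acc.
Qed.
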